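(* Let $\pi$ be a set of primes and let $\mathfrak{F}$ be a formation such that $\mathfrak{F}=\mathtt{S}\mathfrak{F}$. Then: (1) If $\mathfrak{F}$ satisfies the $\pi$-boundary condition (II), then $\mathcal{N}_{\pi'\mathfrak{F}}^{\infty}(G)=Z_{\pi(\mathfrak{N}\circ\mathfrak{F})}(G)$ holds for every finite group $G$. (2) If $\mathcal{N}_{\pi'\mathfrak{F}}^{\infty}(G)=Z_{\pi(\mathfrak{N}\circ\mathfrak{F})}(G)$ holds for every finite group $G$, then $\mathfrak{F}$ satisfies the $\pi$-boundary condition (I). (3) $\mathcal{N}_{\pi'\mathfrak{F}}^{\infty}(G)=Z_{\pi(\mathfrak{N}\circ\mathfrak{F})}(G)$ holds for every finite group $G$ if and only if $\mathcal{N}_{\pi'\mathfrak{F}}^{\infty}(G)=Z_{\pi(\mathfrak{N}\circ\mathfrak{F})}(G)$ holds for every group $G\in \bigcup_{p\in\pi} \left(\mathrm{Crit}_{\mathtt{S}}(\mathfrak{G}_p\circ\mathfrak{F})\setminus (\mathfrak{S}_\pi\circ\mathfrak{F})\right)$.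
   Context: All groups are finite; classes of groups are non-empty and closed under isomorphism. $\mathbb{P}$ is the set of all primes and $\pi'=\mathbb{P}\setminus\pi$. Classes: $\mathfrak{N}$ nilpotent groups; $\mathfrak{G}_p$ $p$-groups; $\mathfrak{S}_\pi$ $\pi$-solvable groups (every chief factor is either a $\pi'$-group or a $p$-group for some $p\in\pi$); $\mathfrak{N}_\pi$ $\pi$-nilpotent groups (groups $G$ with $G/O_{\pi'}(G)$ nilpotent). A formation is a class closed under homomorphic images and subdirect products. $G^{\mathfrak{F}}$ is the smallest normal subgroup $N$ of $G$ with $G/N\in\mathfrak{F}$. For a class $\mathfrak{X}$ and a formation $\mathfrak{F}$, $\mathfrak{X}\circ\mathfrak{F}=\{G: G^{\mathfrak{F}}\in\mathfrak{X}\}$. $\mathfrak{F}=\mathtt{S}\mathfrak{F}$ means $\mathfrak{F}$ is closed under subgroups. The $\pi'\mathfrak{F}$-norm of $G$ is $\mathcal{N}_{\pi'\mathfrak{F}}(G)=\bigcap_{H\leq G}N_G(H^{\mathfrak{F}}O_{\pi'}(G))$. Put $\mathcal{N}^0_{\pi'\mathfrak{F}}(G)=1$ and $\mathcal{N}^{i}_{\pi'\mathfrak{F}}(G)/\mathcal{N}^{i-1}_{\pi'\mathfrak{F}}(G)=\mathcal{N}_{\pi'\mathfrak{F}}(G/\mathcal{N}^{i-1}_{\pi'\mathfrak{F}}(G))$ for $i\ge1$; $\mathcal{N}^{\infty}_{\pi'\mathfrak{F}}(G)$ is the terminal term of this ascending series. For a formation $\mathfrak{M}$, a chief factor $L/K$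 of $G$ is $\mathfrak{M}$-central in $G$ if $(L/K)\rtimes(G/C_G(L/K))\in\mathfrak{M}$. A normal subgroup $N$ of $G$ is $\pi\mathfrak{M}$-hypercentral in $G$ if $N=1$, or $N>1$ and every chief factor of $G$ below $N$ of order divisible by at least one prime in $\pi$ is $\mathfrak{M}$-central in $G$. $Z_{\pi\mathfrak{M}}(G)$ is the product of all $\pi\mathfrak{M}$-hypercentral normal subgroups of $G$; $Z_{\pi(\mathfrak{N}\circ\mathfrak{F})}(G)$ is this subgroup for $\mathfrak{M}=\mathfrak{N}\circ\mathfrak{F}$. $\mathrm{Crit}_{\mathtt{S}}(\mathfrak{X})$ is the class of groups $G\notin\mathfrak{X}$ all of whose proper subgroups belong to $\mathfrak{X}$. $\mathfrak{F}$ satisfies the $\pi$-boundary condition (I) if $\mathrm{Crit}_{\mathtt{S}}(\mathfrak{F})\subseteq\mathfrak{N}_\pi\circ\mathfrak{F}$; it satisfies the $\pi$-boundary condition (II) if $\mathrm{Crit}_{\mathtt{S}}(\mathfrak{G}_p\circ\mathfrak{F})\subseteq\mathfrak{S}_\pi\circ\mathfrak{F}$ for every $p\in\pi$. *)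

(* Defs.v *)
From HB Require Import structures.
From mathcomp Require Import all_boot all_fingroup all_solvable.
From mathcomp Require Import boolp.

Set Implicit Arguments.
Unset Strict Implicit.
Unset Printing Implicit Defensive.

Import GroupScope.

(** * Classes of finite groups *)

Definition group_class := forall gT : finGroupType, {group gT} -> Prop.

Definition isom_closed (X : group_class) :=
  forall (gT rT : finGroupType) (G : {group gT}) (H : {group rT}),
    G \isog H -> X gT G -> X rT H.

Definition nonempty_class (X : group_class) :=
  exists (gT : finGroupType) (G : {group gT}), X gT G.

Definition image_closed (X : group_class) :=
  forall (gT rT : finGroupType) (G : {group gT}) (f : {morphism G >-> rT}),
    X gT G -> X rT (f @* G)%G.

(* H, a subgroup of the external direct product, is a subdirect product of A
   and B when both coordinate projections of H are onto. Closure under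
   subdirect products of two factors gives closure for finitely many. *)
Definition subdirect_closed (X : group_class) :=
  forall (gT rT : finGroupType) (A : {group gT}) (B : {group rT})
         (H : {group gT * rT}),
    [set u.1 | u in H] = A -> [set u.2 | u in H] = B ->
    X gT A -> X rT B -> X (gT * rT)%type H.

Definition subgroup_closed (X : group_class) :=
  forall (gT : finGroupType) (G H : {group gT}),
    H \subset G -> X gT G -> X gT H.

Record formation (F : group_class) : Prop := Formation {
  formation_nonempty : nonempty_class F;
  formation_isom : isom_closed F;
  formation_image : image_closed F;
  formation_subdirect : subdirect_closed F }.

Definition subclass (X Y : group_class) :=
  forall (gT : finGroupType) (G : {group gT}), X gT G -> Y gT G.

Definition nilpotent_groups : group_class := fun _ G => nilpotent G.

Definition p_groups (p : nat) : group_class := fun _ G => p.-group G.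

(* [chief_factor G K L] says that L / K is a chief factor of G. *)
Definition pi_solvable_groups (pi : nat_pred) : group_class := fun gT G =>
  forall K L : {group gT}, chief_factor G K L ->
    pi^'.-group (L / K) \/ exists2 p, p \in pi & p.-group (L / K).

Definition pi_nilpotent_groups (pi : nat_pred) : group_class := fun _ G =>
  nilpotent (G / 'O_pi^'(G)).

(* The F-residual of G. That this is the smallest normal subgroup with quotient
   in F, when F is a formation, is [residualP]. *)
Definition residual (F : group_class) (gT : finGroupType) (G : {group gT}) :
    {group gT} :=
  [group of \bigcap_(N : {group gT} | (N <| G) && `[< F _ (G / N)%G >]) N].

Definition class_comp (X F : group_class) : group_class := fun gT G =>
  X gT (residual F G).

Notation "X \oF F" := (class_comp X F) (at level 50) : group_scope.

Definition critS (X : group_class) : group_class := fun gT G =>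
  ~ X gT G /\ forall H : {group gT}, H \proper G -> X gT H.

Definition boundary_I (pi : nat_pred) (F : group_class) :=
  subclass (critS F) (pi_nilpotent_groups pi \oF F).

Definition boundary_II (pi : nat_pred) (F : group_class) :=
  forall p, p \in pi ->
    subclass (critS (p_groups p \oF F)) (pi_solvable_groups pi \oF F).

(** * The norm and its ascending series *)

Definition norm_piF (pi : nat_pred) (F : group_class)
    (gT : finGroupType) (G : {group gT}) : {group gT} :=
  [group of \bigcap_(H : {group gT} | H \subset G)
               'N_G(residual F H * 'O_pi^'(G))].

Fixpoint norm_series (pi : nat_pred) (F : group_class)
    (gT : finGroupType) (G : {group gT}) (i : nat) : {group gT} :=
  if i is j.+1 then
    let N := norm_series pi F G j in
    (coset N @*^-1 norm_piF pi F (G / N))%G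
  else 1%G.

(* The series is stationary from index #|G| on, see [norm_series_stable]. *)
Definition norm_infty (pi : nat_pred) (F : group_class)
    (gT : finGroupType) (G : {group gT}) : {group gT} :=
  norm_series pi F G #|G|.

(** * Hypercentral subgroups *)

Section ChiefFactorExtension.

Variables (gT : finGroupType) (G K L : {group gT}).
Hypothesis chiefKL : chief_factor G K L.

(* G acts on L / K via ['Q], by conjugation, and 'C_G(L / K | 'Q) is the
   kernel of this action. *)
Lemma chief_factor_acts :
  {acts G / 'C_G(L / K | 'Q), on group L / K | 'Q %% 'C_G(L / K | 'Q)}.
Proof.
have [_ nsLG] := andP chiefKL.
have [/andP[ltKL nKG] _] := maxgroupP (proj1 (andP chiefKL)).
have sKL := proper_sub ltKL; have [sLG nLG] := andP nsLG.
have cC : 'C_G(L / K | 'Q) \subset 'C(L / K | 'Q) by exact: subsetIr.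
have aG : G \subset 'N(L / K | 'Q) by exact: actsQ.
split; first by rewrite astabs_mod ?quotientS.
apply/subsetP => x xLK; rewrite inE /=; apply/andP; split.
  by apply: subsetP xLK; apply: quotientS; apply: subsetT.
apply/afixP => c /setIP[_ cc].
by apply: (astab_act (subsetP cC _ cc)).
Qed.

(* The external semidirect product of L / K by G / C_G(L / K). *)
Definition chief_sdprod : finGroupType :=
  sdprod_by <[chief_factor_acts]>%gact.

End ChiefFactorExtension.

Definition central_chief (M : group_class)
    (gT : finGroupType) (G K L : {group gT}) :=
  exists h : chief_factor G K L, M (chief_sdprod h) [set: chief_sdprod h]%G.

Definition hypercentral (pi : nat_pred) (M : group_class)
    (gT : finGroupType) (G N : {group gT}) :=
  N <| G /\
  (N :=: 1 \/
   N :!=: 1 /\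
   forall K L : {group gT}, chief_factor G K L -> L \subset N ->
     (exists2 p, p \in pi & p %| #|L / K|) -> central_chief M G K L).

(* A [\prod] of groups in [Group_scope] is the subgroup they generate; for
   normal subgroups this is their product. *)
Definition hypercenter (pi : nat_pred) (M : group_class)
    (gT : finGroupType) (G : {group gT}) : {group gT} :=
  (\prod_(N : {group gT} | `[< hypercentral pi M G N >]) N)%G.

(** * Adequacy of [residual] and [norm_infty] *)

Section Adequacy.

Variable F : group_class.
Hypothesis formF : formation F.

Lemma formation_quotientI gT (G M N : {group gT}) :
  M <| G -> N <| G -> F (G / M)%G -> F (G / N)%G -> F (G / (M :&: N))%G.
Proof.
move=> /andP[sMG nMG] /andP[sNG nNG] FM FN.
pose f x := (coset M x, coset N x).
have fM : {in G &, {morph f : x y / x * y}}.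
  by move=> x y Gx Gy; rewrite /f !morphM ?(subsetP nMG) ?(subsetP nNG).
pose fm := Morphism fM.
have kf : 'ker fm = M :&: N.
  apply/setP=> x; apply/idP/idP.
    case/morphpreP=> Gx; rewrite inE /= => /eqP[e1 e2].
    apply/setIP; split; first exact: coset_idr (subsetP nMG _ Gx) e1.
    exact: coset_idr (subsetP nNG _ Gx) e2.
  case/setIP=> Mx Nx; apply/morphpreP; split; first exact: (subsetP sMG).
  by rewrite inE /= /f !coset_id.
have iso : fm @* G \isog G / (M :&: N).
  rewrite isog_sym -kf; exact: first_isog.
apply: (@formation_isom _ formF _ _ (fm @* G)%G (G / (M :&: N))%G iso).
have fE : fm @* G = [set f x | x in G] by rewrite morphimEdom.
by apply: (@formation_subdirect _ formF _ _ (G / M)%G (G / N)%G) => //=;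
  rewrite fE -imset_comp /quotient morphimEsub.
Qed.

Lemma formation_trivial gT (G : {group gT}) : F (G / G)%G.
Proof.
have [rT [H FH]] := formation_nonempty formF.
have := @formation_image _ formF _ _ H (@trivm _ (coset_of G) H) FH.
by congr (F _); apply/val_inj; rewrite /= morphim_trivm trivg_quotient.
Qed.

Lemma residualP gT (G : {group gT}) :
  [/\ residual F G <| G, F (G / residual F G)%G
    & forall N : {group gT}, N <| G -> F (G / N)%G -> residual F G \subset N].
Proof.
have [R [nsR FR minR]] : exists R : {group gT}, [/\ R <| G, F (G / R)%G
    & forall N : {group gT}, N <| G -> F (G / N)%G -> R \subset N].
  pose P (N : {group gT}) := (N <| G) && `[< F (G / N)%G >].
  have PG : P G by rewrite /P normal_refl; apply/asboolP/formation_trivial.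
  case: (arg_minnP (fun N : {group gT} => #|N|) PG) => R.
  case/andP=> nsR /asboolP FR minR.
  exists R; split=> // N nsN FN; apply/setIidPl/eqP.
  rewrite eqEcard subsetIl /=; apply: (minR (R :&: N)%G).
  rewrite /P normalI //; exact/asboolP/formation_quotientI.
suff -> : residual F G = R by [].
apply: group_inj; apply/eqP; rewrite eqEsubset /=; apply/andP; split.
  by apply: bigcap_inf; rewrite nsR; apply/asboolP.
by apply/bigcapsP=> N /andP[nsN /asboolP FN]; apply: minR.
Qed.

End Adequacy.

Lemma norm_series_stable pi F gT (G : {group gT}) n :
  #|G| <= n -> norm_series pi F G n = norm_infty pi F G.
Proof.
pose N := norm_series pi F G.
have NS i : N i.+1 = (coset (N i) @*^-1 norm_piF pi F (G / N i))%G by [].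
have up i : N i \subset N i.+1 by apply: sub_cosetpre.
have sG i : N i \subset G.
  elim: i => [|i IHi]; first exact: sub1G.
  apply: (@subset_trans _ _ (coset (N i) @*^-1 (G / N i))).
    by apply: morphpreS; exact: (bigcap_min 1%G (sub1G _) (subsetIl _ _)).
  by rewrite -quotientInorm quotientGK ?subsetIl // /normal subsetI IHi normG subsetIr.
have stat i j : N i.+1 = N i -> i <= j -> N j = N i.
  move=> eNi; elim: j => [|j IHj]; first by rewrite leqn0 => /eqP->.
  rewrite leq_eqVlt => /predU1P[<- //|lt_ij].
  by rewrite NS IHj // -NS.
have grow i : i < #|N i| \/ N i.+1 = N i.
  elim: i => [|i [lti | eNi]]; first by left; rewrite cards1.
    have [eN | neN] := eqVneq (N i.+1) (N i); first by right; rewrite NS eN -NS.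
    left; apply: leq_ltn_trans lti _; apply: proper_card.
    by rewrite properEneq up andbT eq_sym.
  by right; rewrite (stat i i.+2 eNi) ?leqW // (stat i i.+1 eNi).
move=> leGn; case: (grow #|G|) => [ltG | eqG]; last exact: stat.
by have := leq_trans ltG (subset_leq_card (sG _)); rewrite ltnn.
Qed.

(* Main.v *)
Require Import Defs.
From mathcomp Require Import all_boot all_fingroup all_solvable.
From mathcomp Require Import boolp.

(* Write X for the F-residual of G. A chief factor L / K is (N o F)-central iff X
   centralizes it, abelian or not. So every pi(N o F)-hypercentral subgroup is
   absorbed step by step by the norm series, since X centralizing L / K makes L
   normalize all the residuals of subgroups of G modulo K.

   For the converse inclusion, take G of least order where it fails. Its
   hypercenter is then trivial, and its norm contains a minimal normal subgroup L
   that is the only one of G, is not a pi'-group and is not centralized by X. For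
   H < G not containing L, either LH < G, or LH = G normalizes the residual of H,
   which is then trivial; for H < G containing L, L is hypercentral in H. If L is
   not abelian, this forces all residuals of proper subgroups to be trivial, while
   L <= X. If L is a p-group, the residuals of proper subgroups are p-groups
   modulo C = C_G(L), and X is not; hence C has no proper supplement in G and is a
   p-group by the Frattini argument. If moreover X were pi-solvable, then a
   complement of O_p(X) in O_{p,p'}(X) would be normal in G, again by a Frattini
   argument, which is absurd. So in all cases G is critical for G_p o F with
   residual not pi-solvable, and the assumption of (3) applies to G itself.

   For (2), a critical group for F is its own norm, hence hypercentral in itself;
   factoring out O_pi'(X), every ascending step starting at 1 is central in X, and
   this persists modulo Z(X), so X / O_pi'(X) is nilpotent. *)

Set Implicit Arguments.
Unset Strict Implicit.
Unset Printing Implicit Defensive.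

Import GroupScope.

(** * Residuals *)

Section Residual.

Variable F : group_class.
Hypotheses (formF : formation F) (F_S : subgroup_closed F).

Lemma residual_normal gT (G : {group gT}) : residual F G <| G.
Proof. by have [] := residualP formF G. Qed.

Lemma residual_sub gT (G : {group gT}) : residual F G \subset G.
Proof. exact: normal_sub (residual_normal G). Qed.

Lemma residual_min gT (G N : {group gT}) :
  N <| G -> F (G / N)%G -> residual F G \subset N.
Proof. by have [_ _] := residualP formF G; apply. Qed.

Lemma formation_morphim gT (rT : finGroupType) (D G : {group gT})
    (f : {morphism D >-> rT}) :
  G \subset D -> F G -> F (f @* G)%G.
Proof.
move=> sGD FG; have := @formation_image _ formF _ _ G (restrm sGD f) FG.
by congr (F _); apply/group_inj; rewrite /= morphim_restrm setIid.
Qed.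

Lemma formation_quotient gT (G N : {group gT}) :
  G \subset 'N(N) -> F G -> F (G / N)%G.
Proof. exact: (@formation_morphim _ _ _ _ (coset_morphism N)). Qed.

Lemma residual_quotientP gT (G N : {group gT}) :
  N <| G -> F (G / N)%G <-> residual F G \subset N.
Proof.
move=> nsNG; split=> [|sRN]; first exact: residual_min.
have [nsRG FR _] := residualP formF G.
apply: (formation_isom formF (third_isog sRN nsRG nsNG)).
have nNG : G / residual F G \subset 'N(N / residual F G).
  by rewrite quotient_norms ?normal_norm.
exact: formation_quotient nNG FR.
Qed.

Lemma residual_eq1P gT (G : {group gT}) : F G <-> residual F G :=: 1.
Proof.
have FG1 : F (G / 1)%G <-> F G.
  split; apply: (formation_isom formF); rewrite ?quotient1_isog //.
  by rewrite isog_sym quotient1_isog.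
rewrite -FG1 (residual_quotientP (normal1 G)).
by split=> [/trivgP | ->].
Qed.


(** The group [G / residual F G] maps onto the quotient of the image by [f @* residual F G], which
    bounds the residual of the image from above. Conversely, modulo the preimage of the residual of
    the image, [G] is isomorphic to a group in [F]. *)
Lemma residual_morphim gT (rT : finGroupType) (D G : {group gT})
    (f : {morphism D >-> rT}) :
  G \subset D -> residual F (f @* G)%G :=: f @* residual F G.
Proof.
move=> sGD; pose g := restrm_morphism sGD f.
have eG : (f @* G = g @* G)%G by apply/group_inj;
  rewrite /= morphim_restrm setIid.
rewrite eG -(setIidPr (residual_sub G)) -(morphim_restrm sGD f) -/g.
have [nsRG FR _] := residualP formF G.
apply/eqP; rewrite eqEsubset; apply/andP; split.
  apply: (@residual_min _ (g @* G)%G (g @* residual F G)%G).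
    exact: morphim_normal.
  have := @formation_morphim _ _ _ _ (quotm_morphism g nsRG) (subxx _) FR.
  by congr (F _); apply/group_inj; rewrite /= morphim_quotm.
have [nsR FgG _] := residualP formF (g @* G)%G.
move: (residual F _) nsR FgG => R nsR FgG.
pose N := (g @*^-1 R)%G.
have dom : g @* G \subset 'N(R) by exact: normal_norm.
have fM : {in G &, {morph (fun x => coset R (g x)) : x y / x * y}}.
  by move=> x y Gx Gy; rewrite !morphM // (subsetP dom) // mem_morphim.
pose h := Morphism fM.
have hG : h @* G = (g @* G) / R.
  by rewrite /quotient [RHS]morphimEsub // [g @* G]morphimEdom -imset_comp
    morphimEdom.
have kh : 'ker h = N.
  apply/setP=> x; apply/morphpreP/morphpreP=> -[Gx]; rewrite inE => Rx;
    split=> //.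
    apply: coset_idr (eqP Rx); apply: (subsetP dom); exact: mem_morphim.
    by apply/eqP/coset_id.
rewrite sub_morphim_pre ?residual_sub // -[_ @*^-1 _]/(N : {set gT}) -kh.
apply: residual_min; first exact: ker_normal.
apply: (formation_isom formF) FgG; rewrite /= -hG isog_sym; exact: first_isog.
Qed.

Lemma residual_quotient gT (G N : {group gT}) :
  G \subset 'N(N) -> residual F (G / N)%G :=: residual F G / N.
Proof. exact: residual_morphim. Qed.

Lemma residualJ gT (G : {group gT}) x :
  residual F (G :^ x)%G :=: residual F G :^ x.
Proof.
have eJ (H : {group gT}) : (H :^ x)%G = (conjgm [set: gT] x @* H)%G.
  by apply/group_inj; rewrite /= morphim_conj setTI.
by rewrite eJ residual_morphim ?subsetT //= morphim_conj setTI.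
Qed.

Lemma residualS gT (G H : {group gT}) :
  H \subset G -> residual F H \subset residual F G.
Proof.
move=> sHG; have [nsRG FR _] := residualP formF G.
have nRH := subset_trans sHG (normal_norm nsRG).
have : residual F (H / residual F G)%G :=: 1.
  by apply/residual_eq1P; apply: F_S FR; rewrite quotientS.
rewrite residual_quotient // => /eqP.
by rewrite -subG1 quotient_sub1 // (subset_trans (residual_sub H)).
Qed.

End Residual.

(** * Hypercentral subgroups *)

(** The order [#|L0 : L0 :&: K|] of [L0 / K] divides [#|L0 : L0 :&: M|], the order of the subgroup
    [L0 / M] of [L / M]. *)
Lemma quotient_pgroupS (pi : nat_pred) gT (L M L0 K : {group gT}) :
    L \subset 'N(M) -> L0 \subset 'N(K) -> L0 \subset L -> L0 :&: M \subset K ->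
  pi.-group (L / M) -> pi.-group (L0 / K).
Proof.
move=> nML nKL0 sL0L sMK; apply: pnat_dvd.
apply: (dvdn_trans _ (cardSg (quotientS M sL0L))).
have nML0 := subset_trans sL0L nML.
rewrite !card_quotient // -indexgI -(indexgI L0 M).
by apply: indexgS; rewrite subsetI subsetIl.
Qed.

Section Hypercentral.

Variables (pi : nat_pred) (F : group_class).

(** The factor [L / M] need not be chief; on chief factors the second alternative is centrality, by
    [central_chiefP]. *)
Definition hyp_step gT (G M L : {group gT}) :=
  pi^'.-group (L / M) || ([~: L, residual F G] \subset M).

(* Membership of every chief factor below [N] is replaced by one way to move up
   from every normal subgroup properly contained in [N]: this form passes to
   products, quotients and normal subgroups without Jordan-Hoelder. *)
Definition ascending gT (G N : {group gT}) :=
  N <| G /\ forall M : {group gT}, M <| G -> M \proper N ->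
    exists L : {group gT},
      [/\ L <| G, M \proper L, L \subset N & hyp_step G M L].

Hypotheses (formF : formation F) (F_S : subgroup_closed F).

(** [L0 / (L0 :&: M)] embeds in [L / M] and maps onto [L0 / K]; both alternatives of a step survive
    this. *)
Lemma hyp_stepS gT (G M L L0 K : {group gT}) :
    L <| G -> M <| G -> L0 <| G -> K <| G ->
    L0 \subset L -> L0 :&: M \subset K ->
  hyp_step G M L -> hyp_step G K L0.
Proof.
move=> nsL nsM nsL0 nsK sL0L sMK /orP[piLM | cLM].
  apply/orP; left; apply: quotient_pgroupS piLM => //.
    exact: subset_trans (normal_sub nsL) (normal_norm nsM).
  exact: subset_trans (normal_sub nsL0) (normal_norm nsK).
apply/orP; right; apply: subset_trans sMK; rewrite subsetI.
rewrite commg_subl (subset_trans (residual_sub formF G)) ?normal_norm //=.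
exact: subset_trans (commSg _ sL0L) cLM.
Qed.

Lemma hyp_stepY gT (G M L K : {group gT}) :
    L <| G -> M <| G -> K <| G -> M \subset K ->
  hyp_step G M L -> hyp_step G K (L <*> K)%G.
Proof.
move=> nsL nsM nsK sMK stepML.
have nKL : L \subset 'N(K)
  by exact: subset_trans (normal_sub nsL) (normal_norm nsK).
have nKX : residual F G \subset 'N(K).
  exact: subset_trans (residual_sub formF G) (normal_norm nsK).
have /orP[] : hyp_step G K L.
    by apply: hyp_stepS stepML; rewrite // subIset // sMK orbT.
  by rewrite /hyp_step /= quotientYidr // => ->.
rewrite /hyp_step /= -!quotient_cents2 ?join_subG ?nKL ?normG //=.
by rewrite quotientYidr // => ->; rewrite orbT.
Qed.

Lemma ascending_ind gT (G N : {group gT}) (P : {group gT} -> Prop) :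
    ascending G N -> P 1%G ->
    (forall M L : {group gT}, M <| G -> L <| G -> M \subset L -> L \subset N ->
       hyp_step G M L -> P M -> P L) ->
  P N.
Proof.
move=> [nsN ascN] P1 PS.
pose Q (M : {group gT}) := [&& M <| G, M \subset N & `[< P M >]].
have Q1 : Q 1%G by rewrite /Q normal1 sub1G; apply/asboolP.
case: (arg_maxnP (fun M : {group gT} => #|M|) Q1) =>
  M /and3P[nsM sMN /asboolP PM] maxM.
have [eMN | neMN] := eqVneq M N; first by rewrite -eMN.
have prMN : M \proper N by rewrite properEneq sMN andbT.
have [L [nsL prML sLN stepL]] := ascN M nsM prMN.
have /maxM : Q L.
  by rewrite /Q nsL sLN; apply/asboolP; apply: PS stepL PM => //;
    apply: proper_sub.
by rewrite /= leqNgt proper_card.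
Qed.

Lemma ascending1 gT (G : {group gT}) : ascending G 1%G.
Proof. by split=> [|M _]; rewrite ?normal1 // properE sub1G andbF. Qed.

(** If [M] does not contain [N], a step inside [N] above [M :&: N], joined with [M], is a step above
    [M]. So only the [M] between [N] and [W] need to be provided for. *)
Lemma ascending_extend gT (G N W : {group gT}) :
    W <| G -> ascending G N -> N \subset W ->
    (forall M : {group gT}, M <| G -> N \subset M -> M \proper W ->
       exists L : {group gT},
         [/\ L <| G, M \proper L, L \subset W & hyp_step G M L]) ->
  ascending G W.
Proof.
move=> nsW [nsN ascN] sNW ascW; split=> // M nsM prMW.
have [sNM | nsNM] := boolP (N \subset M); first exact: ascW.
have [] := ascN (M :&: N)%G.
- exact: normalI.
- by rewrite properE subsetIr /= subsetI subxx andbT.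
move=> L [nsL prL sLN stepL]; exists (L <*> M)%G; split.
- exact: normalY.
- rewrite properE joing_subr /= join_subG subxx andbT.
  by apply: contraNN (proper_subn prL) => sLM; rewrite subsetI sLM.
- by rewrite join_subG (subset_trans sLN) // proper_sub.
by apply: hyp_stepY stepL; rewrite ?normalI ?subsetIl.
Qed.

(** A normal [M] below [A <*> B] that contains [A] does not contain [B], so a step of [B] above
    [M :&: B] can be joined with [M]. *)
Lemma ascendingY gT (G A B : {group gT}) :
  ascending G A -> ascending G B -> ascending G (A <*> B)%G.
Proof.
move=> ascA [nsB ascB]; have nsA := ascA.1.
have nsAB : A <*> B <| G by exact: normalY.
apply: (ascending_extend nsAB ascA); first exact: joing_subl.
move=> M nsM sAM prM.
have nsBM : ~~ (B \subset M).
  by apply: contraNN (proper_subn prM) => sBM; rewrite join_subG sAM.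
have [] := ascB (M :&: B)%G.
- exact: normalI.
- by rewrite properE subsetIr /= subsetI subxx andbT.
move=> L [nsL prL sLB stepL]; exists (L <*> M)%G; split.
- exact: normalY.
- rewrite properE joing_subr /= join_subG subxx andbT.
  by apply: contraNN (proper_subn prL) => sLM; rewrite subsetI sLM.
- by rewrite join_subG (subset_trans sLB) ?joing_subr // proper_sub.
by apply: hyp_stepY stepL; rewrite ?normalI ?subsetIl.
Qed.

Lemma ascendingS gT (G N N0 : {group gT}) :
  ascending G N -> N0 <| G -> N0 \subset N -> ascending G N0.
Proof.
move=> [nsN ascN] nsN0 sN0; split=> // M nsM prM.
(* Take a largest normal [K] in [N] that meets [N0] in [M]. By maximality, the next step above [K]
   enlarges the intersection with [N0], and this intersection is the wanted step above [M]. *)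
pose Q (K : {group gT}) := [&& K <| G, K \subset N & K :&: N0 == M].
have sMN0 := proper_sub prM.
have QM : Q M by rewrite /Q nsM (subset_trans sMN0) //=; apply/eqP/setIidPl.
case: (arg_maxnP (fun M : {group gT} => #|M|) QM) =>
  K /and3P[nsK sKN /eqP eK] maxK.
have [| L [nsL prKL sLN stepL]] := ascN K nsK.
  rewrite properEneq sKN andbT; apply: contraNneq (proper_subn prM) => eKN.
  by rewrite -eK eKN subsetI sN0 subxx.
exists (L :&: N0)%G; split; rewrite ?normalI ?subsetIr //.
  rewrite properEneq -{2}eK setSI ?proper_sub // andbT.
  apply: contraTneq prKL => eM; rewrite properEcard negb_and -leqNgt.
  by apply/orP; right; apply: maxK; rewrite /Q nsL sLN /= -eM eqxx.
apply: hyp_stepS stepL; rewrite ?normalI ?subsetIl //.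
by rewrite -eK setIC setIS ?subsetIr.
Qed.

Lemma hyp_step_quotient gT (G N M L : {group gT}) :
    N <| G -> L <| G -> M <| G -> N \subset M -> M \subset L ->
  hyp_step (G / N) (M / N) (L / N) = hyp_step G M L.
Proof.
move=> nsN nsL nsM sNM sML; have nNG := normal_norm nsN.
have nNX : residual F G \subset 'N(N).
  exact: subset_trans (residual_sub formF G) nNG.
have nML := subset_trans (normal_sub nsL) (normal_norm nsM).
have nNL := subset_trans (normal_sub nsL) nNG.
congr (_ || _).
  rewrite /= /pgroup !card_quotient ?quotient_norms //.
  by rewrite index_quotient_eq ?(subset_trans (subsetIr _ _)).
rewrite residual_quotient // -quotientR // quotientSGK //.
apply: subset_trans nNG.
by rewrite comm_subG ?(residual_sub formF) ?normal_sub.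
Qed.

Lemma ascending_quotient gT (G N W : {group gT}) :
    ascending G N -> N \subset W -> W <| G ->
  ascending (G / N)%G (W / N)%G -> ascending G W.
Proof.
move=> ascN sNW nsW [_ ascW]; have nsN := ascN.1.
apply: (ascending_extend nsW ascN) => // M nsM sNM prM.
have nsNM : N <| M by apply: normalS nsN => //; apply: normal_sub.
have nsNW : N <| W by apply: normalS nsN => //; apply: normal_sub.
have [] := ascW (M / N)%G.
- exact: quotient_normal.
- by rewrite quotient_proper.
move=> Lb [nsLb prL sL stepL].
have [L eL sNL nsL] := inv_quotientN nsN nsLb.
have nsNL : N <| L by apply: normalS nsN => //; apply: normal_sub.
move: prL sL stepL; rewrite eL /= quotient_proper // quotientSGK 
  ?normal_norm //.
move=> prL sLW; have -> : Lb = (L / N)%G by exact: group_inj.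
by rewrite hyp_step_quotient ?(proper_sub prL) // => stepL; exists L.
Qed.

Lemma quotient_ascending gT (G E N : {group gT}) :
  E <| G -> ascending G N -> ascending (G / E)%G (N / E)%G.
Proof.
move=> nsE [nsN ascN]; split=> [|Mb nsMb prMb]; first exact: quotient_normal.
have [M eM sEM nsM] := inv_quotientN nsE nsMb.
move: prMb; have -> : Mb = (M / E)%G by exact: group_inj.
(* The element [y] of [N] lies outside the full preimage [M], so a step starts at [M :&: N]; joined
   with [M] it passes to the quotient by [E]. *)
move=> /properP[sMN [_ /morphimP[y Ny N_y ->] notMy]].
have [] := ascN (M :&: N)%G; first exact: normalI.
  rewrite properE subsetIr /=; apply: contra notMy => sNM.
  by rewrite mem_quotient // (subsetP (subset_trans sNM (subsetIl _ _))).
move=> L [nsL prL sLN stepL].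
have nsLM : L <*> M <| G by exact: normalY.
have nsEM : E <| M by exact: normalS sEM (normal_sub nsM) nsE.
have nsELM : E <| L <*> M.
  exact: normalS (subset_trans sEM (joing_subr _ _)) (normal_sub nsLM) nsE.
exists ((L <*> M) / E)%G; split.
- exact: quotient_normal.
- rewrite /= quotient_proper // properE joing_subr /= join_subG subxx andbT.
  by apply: contraNN (proper_subn prL) => sLM; rewrite subsetI sLM.
- have nEL := subset_trans (normal_sub nsL) (normal_norm nsE).
  have nEM := subset_trans (normal_sub nsM) (normal_norm nsE).
  by rewrite /= quotientY // join_subG sMN (quotientS _ sLN).
rewrite hyp_step_quotient ?joing_subr //.
by apply: hyp_stepY stepL; rewrite ?normalI ?subsetIl.
Qed.

End Hypercentral.

(** * Central chief factors *)

Section CentralChief.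

Variable F : group_class.
Hypotheses (formF : formation F) (F_S : subgroup_closed F).
Variables (gT : finGroupType) (G K L : {group gT}).
Hypothesis chiefKL : chief_factor G K L.

Let C := 'C_G(L / K | 'Q)%G.
Let T := chief_sdprod chiefKL.
Let to := <[chief_factor_acts chiefKL]>%gact.
Let V : {group T} := (sdpair1 to @* (L / K))%G.
Let A : {group T} := (sdpair2 to @* (G / C))%G.

Let nKG : G \subset 'N(K).
Proof. by have [/maxgroupp/andP[]] := andP chiefKL. Qed.
Let nsLG : L <| G. Proof. by have [] := andP chiefKL. Qed.
Let sLG : L \subset G. Proof. exact: normal_sub. Qed.
Let nKL : L \subset 'N(K). Proof. exact: subset_trans sLG nKG. Qed.
Let nsCG : C <| G.
Proof.
have aG := actsQ nKG (normal_norm nsLG).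
by rewrite /normal subsetIl normsI ?normG // (subset_trans aG) ?astab_norm.
Qed.


Let toE w g : w \in L / K -> g \in G -> to w (coset C g) = w ^ coset K g.
Proof.
move=> LKw Gg; have Kg := subsetP nKG _ Gg.
have Cg : g \in 'N(C) by rewrite (subsetP (normal_norm nsCG)).
have Qg : g \in qact_dom 'J K by rewrite dom_qactJ.
rewrite /to /= actbyE ?mem_quotient //= modactE //=.
  by have := qactJ w g; rewrite Kg.
apply/afixP => c /setIP[_ cc].
have sC : 'C_G(L / K | 'Q) \subset 'C(L / K | 'Q) by exact: subsetIr.
exact: (astab_act (subsetP sC _ cc)).
Qed.

Let conjV w g : w \in L / K -> g \in G ->
  sdpair1 to w ^ sdpair2 to (coset C g) = sdpair1 to (w ^ coset K g).
Proof. by move=> LKw Gg; rewrite -sdpair_act ?mem_quotient //= toE. Qed.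

Let mulVA : V * A = [set: T]. Proof. exact: im_sdpair. Qed.

Let nsVT : V <| [set: T].
Proof.
rewrite /normal subsetT -mulVA mul_subG ?normG //=.
exact: im_sdpair_norm.
Qed.

(** [C] is the kernel of the action of [G] on [L / K], so [A] acts faithfully on [V]. *)
Let tiAC : 'C(V) :&: A = 1.
Proof.
apply/trivgP/subsetP=> a /setIP[/[swap] /morphimP[_ _ /morphimP[g Ng Gg ->]
  ->{a}] cVa].
rewrite inE -(morph1 (sdpair2 to)) (inj_in_eq (injmP (injm_sdpair2 to)))
  ?mem_quotient //.
apply/eqP/coset_id; rewrite inE Gg /= astabQ inE (subsetP nKG) //=.
rewrite inE; apply/centP=> w LKw; apply/esym/commgP/conjg_fixP.
apply: (injmP (injm_sdpair1 to)) => //.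
  rewrite memJ_norm // (subsetP (quotient_norms K (normal_norm nsLG))) //.
  exact: mem_quotient.
apply: etrans (esym (conjV LKw Gg)) _; apply/conjg_fixP/commgP.
apply: commute_sym; apply: (centP cVa).
by rewrite mem_morphim.
Qed.

(** An element [l] of [L] gives [v] in [V] and [a] in [A] that induce the same conjugation on [V],
    so [v * a^-1] centralizes [V]. This covers abelian and non-abelian [V] alike. *)
Let sTCA : [set: T] \subset 'C(V) * A.
Proof.
have nCA : A \subset 'N('C(V)).
  by rewrite norms_cent // (subset_trans (subsetT _) (normal_norm nsVT)).
have eCA : 'C(V) <*> A = 'C(V) * A by exact: norm_joinEr.
suff sV : V \subset 'C(V) * A.
  rewrite -eCA in sV *; by rewrite -{1}mulVA mul_subG ?joing_subr.
apply/subsetP=> _ /morphimP[_ _ /morphimP[l Nl Ll ->] ->].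
have Gl := subsetP sLG _ Ll.
pose v := sdpair1 to (coset K l); pose a := sdpair2 to (coset C l).
apply/mulsgP; exists (v * a^-1) a.
- apply/centP=> _ /morphimP[w _ LKw ->]; apply/esym/commgP/conjg_fixP.
  have e : sdpair1 to w ^ sdpair1 to (coset K l) =
      sdpair1 to w ^ sdpair2 to (coset C l).
    by rewrite conjV // -morphJ ?mem_quotient.
  by rewrite conjgM e conjgK.
- by apply: mem_morphim; apply: mem_quotient.
by rewrite mulgKV.
Qed.

Let minV (W : {group T}) : W <| [set: T] -> W \subset V -> W :!=: 1 -> W :=: V.
Proof.
move=> nsW sWV ntW; have inj1 := injm_sdpair1 to.
have [_ minLK] := mingroupP (chief_factor_minnormal chiefKL).
pose W0 := (sdpair1 to @*^-1 W)%G.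
have sW0 : W0 \subset L / K by exact: subsetIl.
have eW : sdpair1 to @* W0 = W by rewrite morphpreK.
rewrite -eW (minLK W0) //=.
apply/andP; split; first by apply: contraNneq ntW => W01;
  rewrite -eW /W0 /= W01 morphim1.
apply/subsetP=> _ /morphimP[g _ Gg ->]; rewrite inE;
  apply/subsetP=> _ /imsetP[w W0w ->].
have /morphpreP[LKw Ww] := W0w.
apply/morphpreP; split.
  by rewrite memJ_norm // (subsetP (quotient_norms K (normal_norm nsLG)))
    ?mem_quotient.
suff : sdpair1 to (w ^ coset K g) \in W by [].
by rewrite -conjV // memJ_norm // (subsetP (normal_norm nsW)) ?inE.
Qed.

Let mulCA : 'C(V) * A = [set: T].
Proof. by apply/eqP; rewrite eqEsubset subsetT sTCA. Qed.

Let isoA : G / C \isog A.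
Proof. exact: sub_isog (injm_sdpair2 to). Qed.

Let nsCVT : 'C(V) <| [set: T].
Proof. by rewrite /normal subsetT norms_cent ?normal_norm. Qed.

(** If [R] meets [V] trivially, the two normal subgroups commute. Otherwise nilpotency makes
    [R :&: V :&: 'Z(R)] nontrivial, and by [minV] it is all of [V]. *)
Let residual_cent : nilpotent (residual F [set: T]%G) ->
  residual F [set: T]%G \subset 'C(V).
Proof.
set R := residual F _ => nilR;
  have nsR : R <| [set: T] by exact: residual_normal.
have nsRV : R :&: V <| R.
  by rewrite /normal subsetIl normsI ?normG // (subset_trans (subsetT _))
    ?normal_norm.
have [tiRV | ntRV] := eqVneq (R :&: V) 1.
  apply/commG1P/trivgP; rewrite -tiRV commg_subI //.
    by rewrite subsetI subxx (subset_trans (subsetT _)) ?normal_norm.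
  by rewrite subsetI subxx (subset_trans (subsetT _)) ?normal_norm.
have ntZ := meet_center_nil nilR nsRV ntRV.
have nsZ : R :&: V :&: 'Z(R) <| [set: T].
  apply: normalI; first exact: normalI.
  exact: char_normal_trans (center_char _) nsR.
have sZV : R :&: V :&: 'Z(R) \subset V by rewrite subIset ?subsetIr.
rewrite centsC -(minV nsZ sZV ntZ) (subset_trans (subsetIr _ _)) //.
exact: subsetIr.
Qed.

(* A nilpotent normal subgroup centralizes the minimal normal subgroup V, so a
   nilpotent residual acts trivially on V; conversely, both [T / V] and
   [T / 'C(V)] are images of [G / C], so if this is in F then the residual of T
   lies in the abelian group ['Z(V)]. *)
Lemma chief_sdprod_residual_nil :
  nilpotent (residual F [set: T]%G) <-> [~: L, residual F G] \subset K.
Proof.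
have nKX : residual F G \subset 'N(K)
  by exact: subset_trans (residual_sub formF G) nKG.
have -> : ([~: L, residual F G] \subset K) = (residual F G \subset C).
  by rewrite subsetI residual_sub //= sub_astabQR // commGC.
rewrite -residual_quotientP //; split=> [nilR | FGC].
  have FA : F (A / 'C(V))%G.
    have FT : F ([set: T] / 'C(V))%G by apply/residual_quotientP=> //;
      exact: residual_cent.
    by apply: F_S FT; rewrite quotientS ?subsetT.
  apply: (formation_isom formF) FA; rewrite isog_sym; apply: isog_trans isoA _.
  have nCA := subset_trans (subsetT A) (normal_norm nsCVT).
  exact: (quotient_isog nCA tiAC).
have FA : F A by apply: (formation_isom formF) FGC; exact: isoA.
have sRV : residual F [set: T]%G \subset V.
  apply/residual_quotientP=> //.
  have eT : ([set: T] / V)%G = (A / V)%G.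
    by apply: group_inj; rewrite /= -mulVA quotientMidl.
  rewrite eT; apply: (formation_quotient formF _ FA).
  by rewrite (subset_trans (subsetT _)) ?normal_norm.
have sRC : residual F [set: T]%G \subset 'C(V).
  apply/residual_quotientP=> //.
  have eT : ([set: T] / 'C(V))%G = (A / 'C(V))%G.
    by apply: group_inj; rewrite /= -mulCA quotientMidl.
  rewrite eT; apply: (formation_quotient formF _ FA).
  by rewrite (subset_trans (subsetT _)) ?normal_norm.
apply: abelian_nil; rewrite /abelian (subset_trans sRC) //.
exact: centS.
Qed.

End CentralChief.

Lemma central_chiefP F gT (G K L : {group gT}) :
    formation F -> subgroup_closed F -> chief_factor G K L ->
  central_chief (nilpotent_groups \oF F) G K L <->
  [~: L, residual F G] \subset K.
Proof.
move=> formF F_S chiefKL; split=> [[h] | cLK].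
  by move/(chief_sdprod_residual_nil formF F_S h).
by exists chiefKL; apply/(chief_sdprod_residual_nil formF F_S chiefKL).
Qed.

(** * Hypercentral subgroups as ascending subgroups *)

Section Hypercenter.

Variables (pi : nat_pred) (F : group_class).
Hypothesis pi_primes : forall p, p \in pi -> prime p.
Hypotheses (formF : formation F) (F_S : subgroup_closed F).

Lemma exists_chief_factor gT (G M N : {group gT}) :
    M <| G -> N <| G -> M \proper N ->
  exists2 L : {group gT}, chief_factor G M L & L \subset N.
Proof.
move=> nsM nsN prMN; pose Q (L : {group gT}) :=
  [&& L <| G, M \proper L & L \subset N].
have QN : Q N by rewrite /Q nsN prMN /=.
case: (arg_minnP (fun L : {group gT} => #|L|) QN) =>
  L /and3P[nsL prML sLN] minL.
exists L => //; rewrite /chief_factor nsL andbT.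
apply/maxgroupP; split=> [|K /andP[prKL nKG] sMK];
  first by rewrite prML normal_norm.
apply/esym/eqP; apply: contraTT prKL => neMK.
have prMK : M \proper K by rewrite properEneq neMK.
apply/negP=> prKL; have := minL K;
  rewrite /Q prMK (subset_trans _ sLN) ?proper_sub //.
rewrite /normal nKG (subset_trans (proper_sub prKL)) ?normal_sub //.
by move/(_ isT); rewrite leqNgt proper_card.
Qed.

(** If [L / K] is chief, a step from [K] inside [L] can only end at [L]. Conversely, some chief
    factor inside [N] starts at each normal subgroup properly below [N]. *)
Lemma ascending_chief gT (G N : {group gT}) :
  N <| G ->
  (ascending pi F G N <-> forall K L : {group gT}, chief_factor G K L ->
     L \subset N -> hyp_step pi F G K L).
Proof.
move=> nsN; split=> [ascN K L chiefKL sLN | chiefN].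
  have [maxK nsL] := andP chiefKL.
  have /andP[prKL nKG] := maxgroupp maxK.
  have nsK : K <| G by rewrite /normal nKG (subset_trans (proper_sub prKL))
    ?normal_sub.
  have [_ ascL] := ascendingS formF ascN nsL sLN.
  have [L1 [nsL1 prKL1 sL1 stepL1]] := ascL K nsK prKL.
  suff -> : L = L1 by [].
  apply/esym/group_inj/eqP; rewrite eqEproper sL1;
    apply: contraTN prKL1 => prL1.
  have [_ maxK'] := maxgroupP maxK.
  apply/negP=> prKL1; have := maxK' L1; rewrite prL1 normal_norm // => /(_ isT).
  by rewrite proper_sub // => /(_ isT) e; rewrite e properxx in prKL1.
split=> // M nsM prM; have [L chiefL sLN] := exists_chief_factor nsM nsN prM.
have [maxM nsL] := andP chiefL; have /andP[prML _] := maxgroupp maxM.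
by exists L; split=> //; apply: chiefN.
Qed.

Lemma hypercentralP gT (G N : {group gT}) :
  hypercentral pi (nilpotent_groups \oF F) G N <-> ascending pi F G N.
Proof.
split=> [[nsN hypN] | ascN]; last first.
  have nsN := ascN.1; split=> //.
  have [-> | ntN] := eqVneq (N : {set gT}) 1; [by left | right; split=> //].
  move=> K L chiefKL sLN [p pi_p pKL].
  apply/(central_chiefP formF F_S chiefKL).
  have /orP[|//] := (ascending_chief nsN).1 ascN K L chiefKL sLN.
  move /pgroupP/(_ p (pi_primes pi_p) pKL).
  by rewrite inE /= pi_p.
apply/ascending_chief => // K L chiefKL sLN; rewrite /hyp_step.
have [// | npi] := boolP (pi^'.-group _); rewrite /=.
apply/(central_chiefP formF F_S chiefKL).
case: hypN => [N1 | [_]].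
  case/negP: npi; have -> : L / K = 1; last exact: pgroup1.
  have /trivgP-> : L \subset [1] by rewrite -N1.
  exact: quotient1.
apply=> //; move: npi; rewrite /pgroup /pnat cardG_gt0 /= -has_predC =>
  /hasP[p].
rewrite mem_primes => /and3P[_ _ pKL]; rewrite /= inE /= negbK => pi_p.
by exists p.
Qed.

Lemma ascending_hypercenter gT (G : {group gT}) :
  ascending pi F G (hypercenter pi (nilpotent_groups \oF F) G).
Proof.
rewrite /hypercenter; elim/big_ind: _ => [|A B|N /asboolP/hypercentralP//].
  exact: ascending1.
exact: ascendingY.
Qed.

Lemma hypercenter_normal gT (G : {group gT}) :
  hypercenter pi (nilpotent_groups \oF F) G <| G.
Proof. by have [] := ascending_hypercenter G. Qed.

Lemma ascending_sub_hypercenter gT (G N : {group gT}) :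
  ascending pi F G N -> N \subset hypercenter pi (nilpotent_groups \oF F) G.
Proof.
move=> /hypercentralP hypN; rewrite /hypercenter bigprodGE sub_gen //.
by apply: bigcup_sup; apply/asboolP.
Qed.

End Hypercenter.

(** * The norm *)

Section Norm.

Variables (pi : nat_pred) (F : group_class).
Hypotheses (formF : formation F) (F_S : subgroup_closed F).

(** * Preimages of the norm and of the core of a quotient *)

Section Relative.

Variables (gT : finGroupType) (G : {group gT}).

(** Taking preimages keeps the whole norm series inside [G], where terms over different [M] can be
    compared; [norm_series] iterates [rel_norm G] from 1. *)
Definition rel_pcore (M : {group gT}) := (coset M @*^-1 'O_pi^'(G / M))%G.

Definition rel_norm (M : {group gT}) := (coset M @*^-1 norm_piF pi F (G / M))%G.

Lemma rel_pcore_normal (M : {group gT}) : M <| G -> rel_pcore M <| G.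
Proof. by move=> nsM; rewrite -(quotientGK nsM) cosetpre_normal pcore_normal.
  Qed.

Lemma sub_rel_pcore (M : {group gT}) : M \subset rel_pcore M.
Proof. exact: sub_cosetpre. Qed.

Lemma rel_pcore_max (M L : {group gT}) :
  M <| G -> L <| G -> pi^'.-group (L / M) -> L \subset rel_pcore M.
Proof.
move=> nsM nsL piL; have nML := subset_trans (normal_sub nsL) (normal_norm nsM).
by rewrite -sub_quotient_pre // pcore_max ?quotient_normal.
Qed.

Lemma rel_pcoreS (M1 M2 : {group gT}) :
  M1 <| G -> M2 <| G -> M1 \subset M2 -> rel_pcore M1 \subset rel_pcore M2.
Proof.
move=> nsM1 nsM2 sM12; have nsO := rel_pcore_normal nsM1.
apply: rel_pcore_max => //.
apply: (@quotient_pgroupS _ _ (rel_pcore M1) M1) => //.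
- exact: subset_trans (normal_sub nsO) (normal_norm nsM1).
- exact: subset_trans (normal_sub nsO) (normal_norm nsM2).
- by rewrite subIset // sM12 orbT.
by rewrite /= cosetpreK pcore_pgroup.
Qed.

Lemma norm_piF_sub : norm_piF pi F G \subset G.
Proof. exact: (bigcap_min 1%G (sub1G _) (subsetIl _ _)). Qed.

Lemma mem_norm_piF x : reflect
  (x \in G /\ forall H : {group gT}, H \subset G ->
     x \in 'N(residual F H * 'O_pi^'(G)))
  (x \in norm_piF pi F G).
Proof.
apply: (iffP bigcapP) => [Nx | [Gx Nx] H sHG]; last by rewrite inE Gx Nx.
split=> [|H sHG]; last by have /setIP[] := Nx H sHG.
by have /setIP[] := Nx 1%G (sub1G _).
Qed.

Lemma norm_piF_normal : norm_piF pi F G <| G.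
Proof.
rewrite /normal norm_piF_sub; apply/subsetP=> g Gg; rewrite inE.
apply/subsetP=> _ /imsetP[x /mem_norm_piF[Gx Nx] ->].
apply/mem_norm_piF; split=> [|H sHG]; first exact: groupJ.
rewrite -mem_conjgV -normJ conjsMg (normsP (gFnorm _ _)) ?groupV //.
by rewrite -residualJ // Nx // -(conjGid (groupVr Gg)) conjSg.
Qed.

End Relative.

(** Every subgroup of [G / M] lifts to a subgroup of [G], and residuals commute with quotients, so
    the norm of [G / M] can be tested on products in [G] that contain [M]. *)
Lemma mem_rel_norm gT (G M : {group gT}) x : M <| G -> reflect
  (x \in G /\ forall H : {group gT}, H \subset G ->
     x \in 'N(residual F H * rel_pcore G M))
  (x \in rel_norm G M).
Proof.
move=> nsM; have [sMG nMG] := andP nsM.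
have key (H : {group gT}) : H \subset G -> x \in G ->
    (x \in 'N(residual F H * rel_pcore G M))
      = (coset M x \in 'N(residual F (H / M)%G * 'O_pi^'(G / M))).
  move=> sHG Gx; have Nx := subsetP nMG x Gx; have nMH := subset_trans sHG nMG.
  have nMR := subset_trans (residual_sub formF H) nMH.
  have nOR : residual F H \subset 'N(rel_pcore G M).
    apply: subset_trans (normal_norm (rel_pcore_normal nsM)).
    exact: subset_trans (residual_sub formF H) sHG.
  have nMO : rel_pcore G M \subset 'N(M) by exact: subsetIl.
  have eS : residual F (H / M)%G * 'O_pi^'(G / M) = (residual F H <*> rel_pcore
    G M) / M.
    by rewrite norm_joinEl // quotientMl //= cosetpreK residual_quotient.
  have nMS : residual F H <*> rel_pcore G M \subset 'N(M)
    by rewrite join_subG nMR.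
  rewrite eS -norm_joinEl // !inE -quotientJ // quotientSGK //.
    exact: conj_subG.
  exact: subset_trans (sub_rel_pcore G M) (joing_subr _ _).
apply: (iffP idP) => [/morphpreP[Nx /mem_norm_piF[Gx NHx]] | [Gx NHx]].
  have {}Gx : x \in G by rewrite -(quotientGK nsM) inE Nx inE.
  by split=> // H sHG; rewrite key // NHx ?quotientS.
apply/morphpreP; split; first exact: (subsetP nMG).
apply/mem_norm_piF; split=> [|Hb sHb]; first exact: mem_quotient.
have [H eH sMH sHG] := inv_quotientS nsM sHb.
have -> : Hb = (H / M)%G by exact: group_inj.
by rewrite -key // NHx.
Qed.

Lemma rel_norm1 gT (G : {group gT}) : rel_norm G 1%G :=: norm_piF pi F G.
Proof.
have eO : rel_pcore G 1%G :=: 'O_pi^'(G).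
  rewrite /= pquotient_pcore ?normal1 ?pgroup1 // quotientK ?mul1g //.
  exact: subset_trans (subsetT _) (normal_norm (normal1 [group of setT])).
apply/setP=> x; apply/(mem_rel_norm _ (normal1 G))/mem_norm_piF.
  by case=> Gx Nx; split=> // H sHG; rewrite -eO Nx.
by case=> Gx Nx; split=> // H sHG; rewrite eO Nx.
Qed.

Lemma norm_piF_norms gT (G H : {group gT}) :
    'O_pi^'(G) = 1 -> H \subset G -> norm_piF pi F G \subset 'N(residual F H).
Proof.
move=> O1 sHG; apply/subsetP=> x /mem_norm_piF[_ /(_ H sHG)].
by rewrite O1 mulg1.
Qed.

Lemma rel_normS gT (G M1 M2 : {group gT}) :
  M1 <| G -> M2 <| G -> M1 \subset M2 -> rel_norm G M1 \subset rel_norm G M2.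
Proof.
move=> nsM1 nsM2 sM12; apply/subsetP=> x /(mem_rel_norm _ nsM1)[Gx NHx].
apply/mem_rel_norm => //; split=> // H sHG.
have nsO2 := rel_pcore_normal nsM2.
(* The larger core absorbs the smaller one, so the product over [M2] is the product over [M1] times
   a normal subgroup of [G]; [x] normalizes both factors. *)
rewrite -(mulSGid (rel_pcoreS nsM1 nsM2 sM12)) mulgA.
have Nx2 : x \in 'N(rel_pcore G M2) by rewrite (subsetP (normal_norm nsO2)).
by move: (NHx H sHG); rewrite -!sub1set in Nx2 *; move=> Nx1; apply: normsM.
Qed.

Lemma rel_norm_normal gT (G M : {group gT}) : M <| G -> rel_norm G M <| G.
Proof. by move=> nsM; rewrite -(quotientGK nsM) cosetpre_normal
  norm_piF_normal. Qed.

(** In the first case [L] lies in [rel_pcore G M]. In the second, conjugating [y] in a residual by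
    [x] in [L] multiplies it by [[~ y, x]], which lies in [M]. *)
Lemma hyp_step_rel_norm gT (G M L : {group gT}) :
  M <| G -> L <| G -> hyp_step pi F G M L -> L \subset rel_norm G M.
Proof.
move=> nsM nsL stepL; apply/subsetP=> x Lx.
have Gx := subsetP (normal_sub nsL) x Lx.
have nsO := rel_pcore_normal nsM.
have Nx : x \in 'N(rel_pcore G M) by rewrite (subsetP (normal_norm nsO)).
apply/mem_rel_norm => //; split=> // H sHG.
have nOR : residual F H \subset 'N(rel_pcore G M).
  apply: subset_trans (normal_norm nsO).
  exact: subset_trans (residual_sub formF H) sHG.
rewrite -norm_joinEl //; case/orP: stepL => [piL | cL].
  apply: (subsetP (normG _)); apply: (subsetP (joing_subr _ _)).
  by apply: (subsetP (rel_pcore_max nsM nsL piL)).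
rewrite inE conjYg join_subG (normP Nx) joing_subr andbT.
apply/subsetP=> _ /imsetP[y Ry ->].
have -> : y ^ x = y * [~ y, x] by rewrite commgEl mulKVg.
rewrite groupM //; first exact: (subsetP (joing_subl _ _)).
apply: (subsetP (joing_subr _ _)); apply: (subsetP (sub_rel_pcore G M)).
apply: (subsetP cL); rewrite commGC mem_commg //.
exact: (subsetP (residualS formF F_S sHG)).
Qed.

Lemma norm_series_normal gT (G : {group gT}) i : norm_series pi F G i <| G.
Proof. by elim: i => [|i IHi] /=;
  [exact: normal1 | exact: rel_norm_normal]. Qed.

Lemma norm_infty_normal gT (G : {group gT}) : norm_infty pi F G <| G.
Proof. exact: norm_series_normal. Qed.

Lemma rel_norm_infty gT (G : {group gT}) :
  rel_norm G (norm_infty pi F G) = norm_infty pi F G.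
Proof. exact: (norm_series_stable pi F (leqnSn #|G|)). Qed.

(** Induction along the series, as [rel_norm] is monotone in its lower group. *)
Lemma norm_infty_min gT (G M : {group gT}) :
  M <| G -> rel_norm G M \subset M -> norm_infty pi F G \subset M.
Proof.
move=> nsM sNM; rewrite /norm_infty.
elim: #|G| => [|i IHi]; first exact: sub1G.
exact: subset_trans (rel_normS (norm_series_normal G i) nsM IHi) sNM.
Qed.

Lemma norm_piF_sub_infty gT (G : {group gT}) :
  norm_piF pi F G \subset norm_infty pi F G.
Proof.
rewrite -rel_norm1 -rel_norm_infty.
by rewrite rel_normS ?normal1 ?norm_infty_normal ?sub1G.
Qed.

Lemma ascending_sub_infty gT (G N : {group gT}) :
  ascending pi F G N -> N \subset norm_infty pi F G.
Proof.
move=> ascN; pose P (M : {group gT}) := M \subset norm_infty pi F G.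
apply: (ascending_ind (P := P) ascN); first exact: sub1G.
move=> M L nsM nsL _ _ stepL sM.
apply: subset_trans (hyp_step_rel_norm nsM nsL stepL) _.
by rewrite -rel_norm_infty rel_normS ?norm_infty_normal.
Qed.

(** When the core of [G] is trivial, the norm of [G] normalizes the residuals themselves, and
    elements of [H] always normalize the core of [H]. *)
Lemma norm_piFS gT (G H L : {group gT}) :
    'O_pi^'(G) = 1 -> H \subset G -> L \subset H -> L \subset norm_piF pi F G ->
  L \subset norm_piF pi F H.
Proof.
move=> O1 sHG sLH sLN; apply/subsetP=> x Lx; have Hx := subsetP sLH x Lx.
apply/mem_norm_piF; split=> // K sKH.
have Nx1 : [set x] \subset 'N(residual F K).
  rewrite sub1set (subsetP (norm_piF_norms O1 (subset_trans sKH sHG))) //.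
  exact: (subsetP sLN).
have Nx2 : [set x] \subset 'N('O_pi^'(H))
  by rewrite sub1set (subsetP (gFnorm _ _)).
by rewrite -sub1set normsM.
Qed.

End Norm.

(** * A minimal normal subgroup inside the norm *)

Lemma pgroup_cent_ntriv (p : nat) gT (P L : {group gT}) :
  p.-group P -> p.-group L -> P \subset 'N(L) -> L :!=: 1 -> 'C_L(P) != 1.
Proof.
move=> pP pL nLP ntL; have pPL : p.-group (P <*> L)
  by rewrite norm_joinEl // pgroupM pP.
have nsL : L <| P <*> L by rewrite /normal joing_subr join_subG nLP normG.
have := meet_center_nil (pgroup_nil pPL) nsL ntL; apply: contraNneq => CL1.
rewrite -subG1 -CL1 setIS // (subset_trans (subsetIr _ _)) //.
by rewrite centS ?joing_subl.
Qed.

(** Since [x] commutes with [[~ l, x]], the power [[~ l, x] ^+ #[x]] equals [[~ l, x ^+ #[x]] = 1].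
    So the order of this p-element divides the p'-number [#[x]]. *)
Lemma cent_p'elt (p : nat) (gT : finGroupType) (x l : gT) :
  p^'.-elt x -> p.-elt [~ l, x] -> commute x [~ l, x] -> commute l x.
Proof.
move=> p'x pm cxm; have m1 : [~ l, x] ^+ #[x] = 1.
  by rewrite -commgX // expg_order; exact: commg1.
apply/commgP; rewrite -order_eq1 -dvdn1.
have /eqP <- := pnat_coprime pm p'x.
by rewrite dvdn_gcd dvdnn order_dvdn m1 eqxx.
Qed.

Section MinimalNormal.

Variables (pi : nat_pred) (F : group_class).
Hypotheses (formF : formation F) (F_S : subgroup_closed F).
Variables (gT : finGroupType) (G L : {group gT}).

Let X := residual F G.

Hypothesis uniqL : forall E : {group gT}, E <| G -> E :!=: 1 -> L \subset E.
Hypothesis minL : minnormal L G.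
Hypothesis normsL : forall H :
  {group gT}, H \subset G -> L \subset 'N(residual F H).
Hypothesis ascL : forall H :
  {group gT}, H \proper G -> L \subset H -> ascending pi F H L.
Hypothesis sLG : L \subset G.
Hypothesis ncL : [~: L, X] != 1.

Let nsLG : L <| G. Proof. by have [/andP[_ nLG] _] := mingroupP minL;
  apply/andP. Qed.
Let ntL : L :!=: 1. Proof. by have [/andP[]] := mingroupP minL. Qed.
Let nsXG : X <| G. Proof. exact: residual_normal. Qed.
Let sLX : L \subset X.
Proof. by apply: uniqL => //; apply: contraNneq ncL => ->; rewrite commG1. Qed.

Let ntcL (W : {group gT}) : W <| G -> W \subset L -> W :!=: 1 -> W :=: L.
Proof. by move=> nsW sWL ntW; have [_] := mingroupP minL; apply;
  rewrite ?ntW ?normal_norm. Qed.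

Let joing_proper (H : {group gT}) :
  H \proper G -> ~~ (L \subset H) -> residual F H :!=: 1 ->
  (L <*> H)%G \proper G.
Proof.
move=> prH nsLH; apply: contraR => npr.
have eG : L <*> H = G.
  apply/eqP; move: npr; rewrite properEneq negb_and negbK.
  by rewrite join_subG sLG proper_sub // orbF.
have nsR : residual F H <| G.
  apply/andP; split; first exact: subset_trans (residual_sub formF H)
    (proper_sub prH).
  by rewrite -eG join_subG normsL ?(proper_sub prH) // normal_norm
    ?residual_normal.
apply: contraR nsLH => ntR; apply: subset_trans (residual_sub formF H).
exact: uniqL.
Qed.

(** This reduces to subgroups containing [L]: otherwise a nontrivial residual of [H] lies in that of
    the proper subgroup [L <*> H]. *)
Let residual_proper (P : {group gT} -> Prop) :
    P 1%G -> (forall A B : {group gT}, A \subset B -> P B -> P A) ->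
    (forall H : {group gT}, H \proper G -> L \subset H -> P (residual F H)) ->
  forall H : {group gT}, H \proper G -> P (residual F H).
Proof.
move=> P1 PS PL H prH; have [sLH | nsLH] := boolP (L \subset H);
  first exact: PL.
have [R1 | ntR] := eqVneq (residual F H : {set gT}) 1.
  by have -> : residual F H = 1%G by exact: group_inj.
apply: PS (PL _ (joing_proper prH nsLH ntR) (joing_subl _ _)).
by apply: residualS; rewrite ?joing_subr.
Qed.

(** * The case of a non-abelian minimal normal subgroup *)

Section NonAbelian.

Hypothesis nabL : ~~ abelian L.
Hypothesis npiL : ~~ pi^'.-group L.

Let FL1 : 'F(L) = 1.
Proof.
apply/eqP; apply: contraNT nabL => ntF.
have eF : 'F(L) = L.
  apply: (ntcL (W := 'F(L)%G)) => //; last exact: Fitting_sub.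
  exact: char_normal_trans (Fitting_char L) nsLG.
have nilL : nilpotent L by rewrite -eF Fitting_nil.
have [_ _ /is_abelemP[p _ /abelem_abelian//]] :=
  minnormal_solvable minL (subxx L) (nilpotent_sol nilL).
Qed.

Let nil_normal (W : {group gT}) : W <| L -> nilpotent W -> W :=: 1.
Proof. by move=> nsW nilW; apply/trivgP; rewrite -FL1 Fitting_max. Qed.

Let pi'_normal (W : {group gT}) : W <| L -> pi^'.-group W -> W :=: 1.
Proof.
move=> nsW piW; apply/trivgP; have O1 : 'O_pi^'(L) = 1.
  apply/eqP; apply: contraNT npiL => ntO.
  rewrite -(ntcL (W := 'O_pi^'(L)%G)) ?pcore_pgroup ?pcore_sub //.
  exact: char_normal_trans (pcore_char _ L) nsLG.
by rewrite -O1 pcore_max.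
Qed.

Let cL1 : 'C_G(L) = 1.
Proof.
apply/eqP; apply: contraNT nabL => ntC; rewrite /abelian.
apply: subset_trans (uniqL (E := 'C_G(L)%G) _ ntC) (subsetIr _ _).
by rewrite /normal subsetIl normsI ?normG // norms_cent ?normal_norm.
Qed.

Let residual_proper_nonabelian (H : {group gT}) :
  H \proper G -> residual F H :=: 1.
Proof.
move: H; apply: (residual_proper (P := fun A => A :=: 1)) =>
  // [A B sAB B1 | H prH sLH].
  by apply/trivgP; rewrite (subset_trans sAB) ?B1.
have [sHG _] := andP prH; have nsLH : L <| H by exact: normalS sLH sHG nsLG.
apply/trivgP; rewrite -cL1 subsetI (subset_trans (residual_sub formF H)) //=.
have nsXH : residual F H <| H by exact: residual_normal.
(* Climb from 1 to [L], showing that the residual of [H] centralizes each term. *)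
pose P (M : {group gT}) := residual F H \subset 'C(M).
apply: (ascending_ind (P := P) (ascL prH sLH)); first by rewrite /P cents1.
move=> M L1 nsM nsL1 sML1 sL1L stepL cM; rewrite /P.
pose D := [~: L1, residual F H]%G.
have nsD : D <| H.
  apply/andP; split; first by rewrite comm_subG ?(normal_sub nsL1) ?(normal_sub
    nsXH).
  by rewrite normsR ?(normal_norm nsL1) ?(normal_norm nsXH).
have sDL1 : D \subset L1.
  by rewrite commg_subl (subset_trans (normal_sub nsXH)) ?normal_norm.
have nsML : M <| L.
  exact: normalS (subset_trans sML1 sL1L) (normal_sub nsLH) nsM.
(* By the three subgroups lemma [D] centralizes [M], so [D :&: M] is abelian and normal in [L],
   hence trivial. Then [D] embeds in [L1 / M], and either kind of step forces [D] to be 1. *)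
have cDM : D \subset 'C(M).
  apply: comm_norm_cent_cent => //.
    exact: subset_trans (normal_sub nsXH) (normal_norm nsL1).
  exact: subset_trans (normal_sub nsL1) (normal_norm nsM).
have tiDM : D :&: M = 1.
  apply: (nil_normal (W := (D :&: M)%G)).
    apply: normalI => //.
    exact: normalS (subset_trans sDL1 sL1L) (normal_sub nsLH) nsD.
  apply/abelian_nil; rewrite /abelian /= (subset_trans (subsetIl _ _)) //.
  by rewrite (subset_trans cDM) // centS ?subsetIr.
rewrite centsC; apply/commG1P; case/orP: stepL => [piL | sDM]; last first.
  by rewrite -tiDM; apply/esym/setIidPl.
apply: (pi'_normal (W := D)).
  exact: normalS (subset_trans sDL1 sL1L) (normal_sub nsLH) nsD.
have nMD : D \subset 'N(M)
  by exact: subset_trans (normal_sub nsD) (normal_norm nsM).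
have := quotient_isog nMD; rewrite setIC => /(_ tiDM)/isog_pgroup->.
exact: pgroupS (quotientS M sDL1) piL.
Qed.

Lemma nonabelian_critical : exists p, [/\ p \in pi,
  critS (p_groups p \oF F) G & ~ (pi_solvable_groups pi \oF F) G].
Proof.
have [p pi_p pL] : exists2 p, p \in pi & p %| #|L|.
  move: npiL; rewrite /pgroup /pnat cardG_gt0 /= -has_predC => /hasP[p].
  rewrite mem_primes => /and3P[_ _ pL]; rewrite /= inE /= negbK => pi_p.
  by exists p.
exists p; split=> //.
  split=> [/(pgroupS sLX)/pgroup_nil nilL | H prH].
    by have := ntL; rewrite (nil_normal (normal_refl L) nilL) eqxx.
  by rewrite /class_comp /p_groups residual_proper_nonabelian ?pgroup1.
move=> solX; have nsLX : L <| X by exact: normalS sLX (normal_sub nsXG) nsLG.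
have prL : 1%G \proper L by rewrite properEneq eq_sym ntL sub1G.
(* A minimal normal subgroup [U] of [X] inside [L] is normal in [L], which has no nontrivial normal
   subgroup that is nilpotent or a pi'-group. *)
have [U chiefU sUL] := exists_chief_factor (normal1 X) nsLX prL.
have [/maxgroupp/andP[prU _] nsUX] := andP chiefU.
have nsUL : U <| L by exact: normalS sUL sLX nsUX.
suff U1 : U :=: 1 by rewrite U1 properxx in prU.
have nU1 : U \subset 'N(1) by rewrite norm1 subsetT.
have [] := solX _ _ chiefU.
  by rewrite pquotient_pgroup ?pgroup1 //; exact: pi'_normal.
case=> q _; rewrite pquotient_pgroup ?pgroup1 // => /pgroup_nil.
exact: nil_normal.
Qed.

End NonAbelian.

(** * The case of a minimal normal p-subgroup *)

Section PGroup.

Variable p : nat.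
Hypotheses (pi_p : p \in pi) (pL : p.-group L).

Let C := 'C_G(L)%G.

Let nsCG : C <| G.
Proof. by rewrite /normal subsetIl normsI ?normG // norms_cent ?normal_norm.
  Qed.

Let p'_normal (W : {group gT}) : W <| G -> p^'.-group W -> W :=: 1.
Proof.
move=> nsW p'W; apply/eqP; apply: contraNT ntL => ntW.
have sLW := uniqL nsW ntW.
by rewrite trivg_card1 (pnat_1 pL (pgroupS sLW p'W)).
Qed.

Let cent_p_normal (P : {group gT}) : P <| G -> p.-group P -> P \subset C.
Proof.
move=> nsP pP; have nLP := subset_trans (normal_sub nsP) (normal_norm nsLG).
rewrite subsetI normal_sub //= centsC.
have <- : 'C_L(P) = L :> {set gT}; last exact: subsetIr.
apply: (ntcL (W := 'C_L(P)%G)); rewrite ?subsetIl //.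
  by rewrite /normal subIset ?sLG //= normsI ?norms_cent ?normal_norm.
exact: pgroup_cent_ntriv pP pL nLP ntL.
Qed.

(** Otherwise [X] lies in [C * P] for a Sylow p-subgroup [P], so ['C_L(X)] contains ['C_L(P)], which
    is nontrivial. By minimality [X] would centralize [L], against [ncL]. *)
Let not_pXC : ~~ p.-group (X / C).
Proof.
apply: contraNN ncL => pXC.
have [P sylP] := Sylow_exists p X.
have nCX : X \subset 'N(C)
  by exact: subset_trans (normal_sub nsXG) (normal_norm nsCG).
have sPX := pHall_sub sylP.
have sXPC : X \subset C * P.
  by rewrite -quotientSK // (pHall_id (quotient_pHall (subset_trans sPX nCX)
    sylP)).
have nLX : X \subset 'N(L)
  by exact: subset_trans (normal_sub nsXG) (normal_norm nsLG).
have ntC := pgroup_cent_ntriv (pHall_pgroup sylP) pL (subset_trans sPX nLX) ntL.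
apply/eqP/commG1P; have <- : 'C_L(X) = L :> {set gT}; last exact: subsetIr.
apply: (ntcL (W := 'C_L(X)%G)); rewrite ?subsetIl //.
  by rewrite /normal subIset ?sLG //= normsI ?norms_cent ?normal_norm.
apply: contraNneq ntC => CX1; rewrite -subG1 -CX1 subsetI subsetIl centsC.
rewrite (subset_trans sXPC) // mul_subG //.
  by rewrite (subset_trans (subsetIr _ _)) // centS ?subsetIl.
by rewrite centsC subsetIr.
Qed.

Let residual_proper_p (H : {group gT}) :
  H \proper G -> p.-group (residual F H / C).
Proof.
move: H; apply: (residual_proper (P := fun A => p.-group (A / C))).
- by rewrite quotient1 pgroup1.
- by move=> A B sAB; apply: pgroupS; rewrite quotientS.
move=> H prH sLH.
(* Every p'-element of the residual of [H] centralizes [L], again by climbing. A pi'-step inside the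
   p-group [L] is trivial because [p] is in [pi]; at a central step [cent_p'elt] applies. *)
have cent x : x \in residual F H -> p^'.-elt x -> x \in 'C(L).
  move=> Rx p'x; pose P (M : {group gT}) := x \in 'C(M).
  apply: (ascending_ind (P := P) (ascL prH sLH));
    first by rewrite /P cent1T inE.
  move=> M L1 nsM nsL1 sML1 sL1L stepL cM; rewrite /P.
  have pL1 : p.-group L1 by exact: pgroupS pL.
  case/orP: stepL => [piL1 | cL1M].
    have pLM : p.-nat #|L1 / M| by exact: quotient_pgroup.
    have p'LM : p^'.-nat #|L1 / M|.
      by apply: sub_in_pnat piL1 => q _; apply: contraNN => /eqP->.
    move/eqP: (pnat_1 pLM p'LM);
      rewrite -trivg_card1 -subG1 quotient_sub1 => [sL1M|].
      by rewrite (subsetP (centS sL1M)).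
    exact: subset_trans (normal_sub nsL1) (normal_norm nsM).
  apply/centP=> l Ll; apply/commute_sym.
  have Mlx : [~ l, x] \in M by apply: (subsetP cL1M); rewrite mem_commg.
  apply: cent_p'elt p'x _ _.
    by apply: mem_p_elt pL1 _; apply: (subsetP sML1).
  exact: (centP cM).
have sRC : residual F H \subset 'N(C).
  apply: subset_trans (normal_norm nsCG).
  exact: subset_trans (residual_sub formF H) (proper_sub prH).
apply/pgroupP=> q q_pr /(Cauchy q_pr)[_ /morphimP[x Nx Rx ->] ox].
have Cx : x.`_p^' \in C.
  have Rx' : x.`_p^' \in residual F H by rewrite groupX.
  rewrite inE cent ?p_elt_constt ?Rx' // andbT.
  by rewrite (subsetP (proper_sub prH)) // (subsetP (residual_sub formF H)).
have : p.-elt (coset C x).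
  rewrite -[x](consttC p) morphM ?groupX //= (coset_id Cx) mulg1.
  by rewrite morph_p_elt ?groupX ?p_elt_constt.
by rewrite /p_elt ox pnatE.
Qed.

(* This plays the role of [C \subset 'Phi(G)]. *)
Let supplement (N : {group gT}) : N \subset G -> G \subset C * N -> N :=: G.
Proof.
move=> sNG sGCN; apply/eqP; apply: contraNT not_pXC => neNG.
have prN : N \proper G by rewrite properEneq neNG.
have e : (G / C = N / C)%G.
  apply/group_inj/eqP; rewrite eqEsubset /= (quotientS _ sNG) andbT.
  by rewrite -[N / C]quotientMidl quotientS.
have nCN := subset_trans sNG (normal_norm nsCG).
rewrite -residual_quotient ?normal_norm // e residual_quotient //.
exact: residual_proper_p.
Qed.

(** For [q] other than [p], the Frattini argument and [supplement] make a Sylow q-subgroup of [C]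
    normal in [G], hence trivial. *)
Let pC : p.-group C.
Proof.
apply/pgroupP=> q q_pr qC; apply: contraTT qC => neqp.
have [Q sylQ] := Sylow_exists q C.
have nsQ : Q <| G.
  have eQ := Frattini_arg nsCG sylQ.
  have : 'N_G(Q) = G :> {set gT}.
    by apply: (supplement (N := 'N_G(Q)%G)); rewrite ?subsetIl //= eQ.
  move/setIidPl=> nQG; rewrite /normal nQG andbT.
  exact: subset_trans (pHall_sub sylQ) (normal_sub nsCG).
have Q1 : Q :=: 1.
  apply: p'_normal => //; apply: sub_in_pnat (pHall_pgroup sylQ) => r _ /eqP->.
  by rewrite inE.
by rewrite -p'natE // -partn_eq1 ?cardG_gt0 // -(card_Hall sylQ) Q1 cards1.
Qed.

Let not_pX : ~~ p.-group X.
Proof. by apply: contraNN not_pXC; apply: quotient_pgroup. Qed.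

Lemma pgroup_critical : exists p, [/\ p \in pi,
  critS (p_groups p \oF F) G & ~ (pi_solvable_groups pi \oF F) G].
Proof.
exists p; split=> //.
  split=> [pX | H prH]; first by case/negP: not_pX.
  rewrite /class_comp /p_groups -(pquotient_pgroup pC) ?residual_proper_p //.
  apply: subset_trans (normal_norm nsCG).
  exact: subset_trans (residual_sub formF H) (proper_sub prH).
move=> solX; pose O := 'O_p(X)%G; pose T := 'O_{p, p^'}(X)%G.
have nsOX : O <| X by exact: pcore_normal.
have nsOG : O <| G by exact: char_normal_trans (pcore_char p X) nsXG.
have nsTG : T <| G by exact: char_normal_trans (pseries_char _ X) nsXG.
have pO : p.-group O by exact: pcore_pgroup.
have sOC : O \subset C by exact: cent_p_normal.
have prO : O \proper X.
  rewrite properEneq normal_sub // andbT; apply: contraNneq not_pX => <-.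
  exact: pcore_pgroup.
(* A p-group [U / O] would put [U] inside [O]. So pi-solvability makes [U / O] a p'-group, and [T]
   is strictly larger than [O]. *)
have [U chiefU _] := exists_chief_factor nsOX (normal_refl X) prO.
have [/maxgroupp/andP[prOU _] nsUX] := andP chiefU.
have sOT : O \subset T by rewrite /= -pseries1 (pseries_sub_catl [:: _] [:: _]).
have eT : T / O = 'O_p^'(X / O) by exact: quotient_pseries2.
have prOT : O \proper T.
  apply: (proper_sub_trans prOU).
  have nOU : U \subset 'N(O)
    by exact: subset_trans (normal_sub nsUX) (normal_norm nsOX).
  have nOT : T \subset 'N(O)
    by exact: subset_trans (normal_sub nsTG) (normal_norm nsOG).
  rewrite -(quotientSGK nOU sOT) eT pcore_max ?quotient_normal //.
  have [] := solX _ _ chiefU; first by apply: sub_in_pnat => q _;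
    apply: contraNN => /eqP->.
  case=> q pi_q qU; apply: sub_in_pnat (qU) => r _ /eqP->; apply/eqP=> eqp.
  have pU : p.-group U by move: qU; rewrite eqp pquotient_pgroup.
  by case/andP: prOU => _ /negP[]; exact: pcore_max.
have nsOT : O <| T by exact: normalS sOT (normal_sub nsTG) nsOG.
have hallO : Hall T O.
  rewrite /Hall normal_sub //= -card_quotient ?normal_norm // eT.
  exact: pnat_coprime pO (pcore_pgroup _ _).
have /splitsP[Q /complP[tiOQ eOQ]] := SchurZassenhaus_split hallO nsOT.
have p'Q : p^'.-group Q.
  have nOQ : Q \subset 'N(O).
    by apply: subset_trans (normal_norm nsOT); rewrite -eOQ mulG_subr.
  rewrite (isog_pgroup _ (quotient_isog nOQ tiOQ)).
  by rewrite /= -quotientMidl eOQ eT pcore_pgroup.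
have nsQ : Q <| G.
  have sQG : Q \subset G by rewrite (subset_trans _ (normal_sub nsTG)) // -eOQ
    mulG_subr.
  have : 'N_G(Q) = G :> {set gT}; last by move/setIidPl=> nQG;
    rewrite /normal sQG.
  apply: (supplement (N := 'N_G(Q)%G)); first exact: subsetIl.
  (* The conjugate of [Q] by [g] is another complement of [O] in [T], hence conjugate to [Q] by some
     [x] in [O]. So [g * x^-1] normalizes [Q], and [C] supplements the normalizer. *)
  apply: subset_trans (mulSg _ sOC); apply/subsetP=> g Gg.
  have nOQ : Q \subset 'N(O).
    by apply: subset_trans (normal_norm nsOT); rewrite -eOQ mulG_subr.
  have sQg : (Q :^ g)%G \subset O * Q.
    by rewrite eOQ -(normsP (normal_norm nsTG) g Gg) conjSg -eOQ mulG_subr.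
  have coOQ : coprime #|O| #|Q| by exact: pnat_coprime pO p'Q.
  have [x Ox /= eQ] := SchurZassenhaus_trans_sol (pgroup_sol pO) nOQ sQg coOQ
    (cardJg _ _).
  have Gx : x \in G by exact: (subsetP (normal_sub nsOG)).
  rewrite -normC; last first.
    by rewrite (subset_trans (subsetIl _ _)) ?normal_norm.
  apply/mulsgP; exists (g * x^-1) x; rewrite ?mulgKV //.
  rewrite inE groupM ?groupV //=; apply/normP; rewrite conjsgM eQ -conjsgM.
  by rewrite mulgV conjsg1.
have Q1 := p'_normal nsQ p'Q.
by rewrite -eOQ Q1 mulg1 properxx in prOT.
Qed.

End PGroup.

End MinimalNormal.

(** * The theorem *)

Section MainTheorem.

Variables (pi : nat_pred) (F : group_class).
Hypothesis pi_primes : forall p, p \in pi -> prime p.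
Hypotheses (formF : formation F) (F_S : subgroup_closed F).

Local Notation Z G := (hypercenter pi (nilpotent_groups \oF F) G).
Local Notation Ninf G := (norm_infty pi F G).

Lemma minnormal_ascending gT (G L : {group gT}) :
  minnormal L G -> L \subset G -> hyp_step pi F G 1 L -> ascending pi F G L.
Proof.
case/mingroupP=> /andP[ntL nLG] minL sLG stepL; have nsL : L <| G by apply/andP.
split=> // M nsM prM; have M1 : M = 1%G.
  have sML := proper_sub prM; apply/group_inj/eqP;
    apply: contraTT prM => /= ntM.
  by rewrite (minL M) ?ntM ?normal_norm ?properxx.
by exists L; rewrite M1 proper1G.
Qed.

Definition critical gT (G : {group gT}) := exists p, [/\ p \in pi,
  critS (p_groups p \oF F) G & ~ (pi_solvable_groups pi \oF F) G].

Lemma hypercenter_sub_norm_infty gT (G : {group gT}) : Z G \subset Ninf G.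
Proof.
by apply: ascending_sub_infty => //; apply: ascending_hypercenter.
Qed.

Lemma norm_infty_sub_hypercenter :
    (forall (gT : finGroupType) (G : {group gT}), critical G -> Ninf G = Z G) ->
  forall (gT : finGroupType) (G : {group gT}), Ninf G \subset Z G.
Proof.
move=> eq_crit gT G; move: {2}_.+1 (ltnSn #|G|) => n.
elim: n => // n IHn in gT G *; rewrite ltnS => leGn.
have IH (rT : finGroupType) (H : {group rT}) :
  #|H| < #|G| -> norm_piF pi F H \subset Z H.
  move=> ltHG; apply: subset_trans (norm_piF_sub_infty pi formF H) _.
  by apply: IHn; apply: leq_trans ltHG leGn.
have nsZ : Z G <| G by exact: hypercenter_normal.
have [Z1 | ntZ] := eqVneq (Z G : {set gT}) 1; last first.
  (* The hypercenter of [G / Z G] lifts to an ascending subgroup, so it is trivial. By induction the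
     norm of [G / Z G] is trivial too, and the series cannot leave [Z G]. *)
  have ascZ := ascending_hypercenter pi_primes formF F_S.
  have [U eU sZU nsU] := inv_quotientN nsZ (hypercenter_normal pi_primes formF
    F_S (G / Z G)).
  apply: norm_infty_min => //.
  have sU : U \subset Z G.
    apply: ascending_sub_hypercenter => //.
    apply: (ascending_quotient formF (ascZ _ G) sZU nsU).
    by have := ascZ _ (G / Z G)%G; rewrite (group_inj eU : Z _ = (U / Z G)%G).
  apply: subset_trans sU; rewrite -(quotientGK (normalS sZU (normal_sub nsU)
    nsZ)) morphpreS //.
  by rewrite -eU IH // ltn_quotient ?normal_sub.
have no_asc (L : {group gT}) : ascending pi F G L -> L :=: 1.
  by move/(ascending_sub_hypercenter pi_primes formF F_S);
    rewrite Z1 => /trivgP.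
have [N1 | ntN] := eqVneq (norm_piF pi F G : {set gT}) 1.
  apply: subset_trans (sub1G _); apply: (norm_infty_min formF (M := 1%G));
    first exact: normal1.
  by rewrite rel_norm1 // N1.
have nsN := norm_piF_normal pi formF G.
have [L minL sLN] := minnormal_exists ntN (normal_norm nsN).
have [/andP[ntL nLG] _] := mingroupP minL.
have sLG : L \subset G := subset_trans sLN (normal_sub nsN).
have nsLG : L <| G by apply/andP.
have nstep : ~~ hyp_step pi F G 1 L.
  by apply: contraNN ntL => /(minnormal_ascending minL sLG)/no_asc->.
have npiL : ~~ pi^'.-group L.
  apply: contraNN nstep => piL;
    rewrite /hyp_step pquotient_pgroup ?pgroup1 ?piL //.
  by rewrite norm1 subsetT.
have ncL : [~: L, residual F G] != 1.
  by apply: contraNN nstep => /eqP cL; rewrite /hyp_step cL subxx orbT.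
have uniqL (E : {group gT}) : E <| G -> E :!=: 1 -> L \subset E.
  move=> nsE ntE; apply: contraR nstep => nsLE.
  have tiLE : L :&: E = 1.
    apply/eqP; apply: contraNT nsLE => ntLE.
    have [_ /(_ (L :&: E)%G)] := mingroupP minL.
    rewrite ntLE subsetIl normal_norm ?normalI // => /(_ isT isT)/setIidPl.
    by [].
  have nLE : L \subset 'N(E) := subset_trans sLG (normal_norm nsE).
  (* The image of [L] lies in the norm of the smaller group [G / E], so it is ascending there. Its
     first step [K / E] has [K] inside [E * L], so by the modular law [K] meets [L] and contains it;
     thus [L] would be a step above 1. *)
  have sLEN : L / E \subset norm_piF pi F (G / E).
    rewrite sub_quotient_pre //; apply: subset_trans sLN _.
    by rewrite -(rel_norm1 pi formF) (rel_normS pi formF) ?normal1 ?sub1G.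
  have nsLEQ : (L / E)%G <| (G / E)%G by exact: quotient_normal.
  have ascLE : ascending pi F (G / E)%G (L / E)%G.
    apply: ascendingS (ascending_hypercenter pi_primes formF F_S _) nsLEQ _ =>
      //.
    by apply: subset_trans sLEN (IH _ _ _); rewrite ltn_quotient ?normal_sub.
  have [_ /(_ 1%G (normal1 _))[]] := ascLE.
    by rewrite proper1G -subG1 quotient_sub1.
  move=> Kb [nsKb]; have [K eK sEK nsK] := inv_quotientN nsE nsKb.
  have -> : Kb = (K / E)%G by exact: group_inj.
  have nsEK := normalS sEK (normal_sub nsK) nsE.
  have -> : 1%G = (E / E)%G by apply: group_inj; rewrite /= trivg_quotient.
  have nEK := subset_trans (normal_sub nsK) (normal_norm nsE).
  rewrite /= quotient_proper // quotientSK // => prEK sKEL.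
  rewrite hyp_step_quotient ?(proper_sub prEK) // => stepEK.
  apply: (hyp_stepS formF _ _ _ _ _ _ stepEK) => //; rewrite ?normal1 ?tiLE //.
  have [LK1 | ntLK] := eqVneq (L :&: K) 1; last first.
    have [_ /(_ (L :&: K)%G)] := mingroupP minL.
    by rewrite ntLK subsetIl normal_norm ?normalI // => /(_ isT isT)/setIidPl.
  case/andP: prEK => _ /negP[]; rewrite -(mulg1 E) -LK1 group_modl //.
  by rewrite subsetI sKEL subxx.
have O1 : 'O_pi^'(G) = 1.
  apply/eqP; apply: contraNT npiL => ntO.
  exact: pgroupS (uniqL 'O_pi^'(G)%G (pcore_normal _ _) ntO) (pcore_pgroup _ _).
have normsL (H : {group gT}) : H \subset G -> L \subset 'N(residual F H).
  by move=> sHG; apply: subset_trans sLN (norm_piF_norms F O1 sHG).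
have ascL (H : {group gT}) : H \proper G -> L \subset H -> ascending pi F H L.
  move=> prH sLH; have nsLH := normalS sLH (proper_sub prH) nsLG.
  apply: ascendingS (ascending_hypercenter pi_primes formF F_S H) nsLH _ => //.
  apply: subset_trans (IH _ H (proper_card prH)).
  exact: norm_piFS O1 (proper_sub prH) sLH sLN.
(* No contradiction is sought here: it remains to show that [G] is critical, where equality is
   assumed. *)
rewrite eq_crit //; have [abL | nabL] := boolP (abelian L); last first.
  exact: (nonabelian_critical formF F_S uniqL minL normsL ascL sLG ncL nabL
    npiL).
have [_ _ /is_abelemP[p _ /abelem_pgroup pL]] :=
  minnormal_solvable minL (subxx L) (abelian_sol abL).
have pi_p : p \in pi.
  apply: contraNT npiL => npi_p; apply: sub_in_pnat pL => q _ /eqP->.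
  by rewrite inE.
exact: (pgroup_critical formF F_S uniqL minL normsL ascL sLG ncL pi_p pL).
Qed.

(** The center is a pi-group, so it has a complement [Q] in the preimage [W] of the core of the
    quotient. Since the center centralizes [Q], this pi'-group is normal in [W], hence lies in the
    core of [W], which is trivial. *)
Lemma pcore_quotient_center gT (G : {group gT}) :
  'O_pi^'(G) = 1 -> 'O_pi^'(G / 'Z(G)) = 1.
Proof.
move=> O1; pose W := (coset 'Z(G) @*^-1 'O_pi^'(G / 'Z(G)))%G.
have nsZG := center_normal G.
have eW : W / 'Z(G) = 'O_pi^'(G / 'Z(G)) by rewrite cosetpreK.
have nsW : W <| G by rewrite -(quotientGK nsZG) cosetpre_normal pcore_normal.
have sZW : 'Z(G) \subset W by exact: sub_cosetpre.
have nsZW : 'Z(G) <| W by exact: normalS sZW (normal_sub nsW) nsZG.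
have pi'1 (Q : {group gT}) : Q <| G -> pi^'.-group Q -> Q :=: 1.
  by move=> nsQ piQ; apply/trivgP; rewrite -O1 pcore_max.
have piZ : pi.-group 'Z(G).
  have OZ1 : 'O_pi^'('Z(G)) = 1.
    apply: pi'1 (pcore_pgroup _ _).
    exact: char_normal_trans (pcore_char _ _) nsZG.
  have := nilpotent_pcoreC pi (abelian_nil (center_abelian G)).
  by rewrite OZ1 dprodg1 => <-; apply: pcore_pgroup.
have hallZ : Hall W 'Z(G).
  rewrite /Hall sZW -card_quotient ?normal_norm // eW.
  exact: pnat_coprime piZ (pcore_pgroup _ _).
have /splitsP[Q /complP[tiZQ eZQ]] := SchurZassenhaus_split hallZ nsZW.
have sQW : Q \subset W by rewrite -eZQ mulG_subr.
have nZQ := subset_trans sQW (normal_norm nsZW).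
have p'Q : pi^'.-group Q.
  rewrite (isog_pgroup _ (quotient_isog nZQ tiZQ)).
  by rewrite /= -quotientMidl eZQ eW pcore_pgroup.
have nsQW : Q <| W.
  rewrite /normal sQW -eZQ mul_subG ?normG // cents_norm //.
  rewrite (subset_trans (subsetIr G _)) // centS //.
  exact: subset_trans sQW (normal_sub nsW).
have /trivgP Q1 : Q \subset [1].
  have <- : 'O_pi^'(W) = 1; last exact: pcore_max.
  by apply: pi'1 (pcore_pgroup _ _);
    apply: char_normal_trans (pcore_char _ _) nsW.
by rewrite -eW -eZQ Q1 mulg1 trivg_quotient.
Qed.

Lemma ascending_residual_nil gT (G : {group gT}) :
  ascending pi F G (residual F G) -> 'O_pi^'(residual F G) = 1 ->
  nilpotent (residual F G).
Proof.
move: {2}_.+1 (ltnSn #|residual F G|) => n.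
elim: n => // n IHn in gT G *; rewrite ltnS => leXn;
  set X := residual F G in leXn *.
move=> ascX O1; have [-> | ntX] := eqVneq (X : {set gT}) 1;
  first exact: nilpotent1.
have nsXG : X <| G by exact: residual_normal.
have nsZX := center_normal X.
have nsZG : 'Z(X) <| G by exact: char_normal_trans (center_char X) nsXG.
have ntZ : 'Z(X) != 1.
  (* The first step above 1 inside [X] is not a pi'-group, so it is centralized by [X] and lies in
     ['Z(X)]. *)
  have [_ /(_ 1%G (normal1 G))[]] := ascX; first by rewrite proper1G.
  move=> L [nsL]; rewrite proper1G => ntL sLX /orP[|/trivgP/commG1P cLX].
    rewrite pquotient_pgroup ?pgroup1 ?norm1 ?subsetT // => piL.
    case/negP: ntL; rewrite -subG1 -O1 pcore_max //.
    exact: normalS sLX (normal_sub nsXG) nsL.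
  by apply: contraNneq ntL => Z1; rewrite -subG1 -Z1 subsetI sLX.
rewrite -quotient_center_nil.
have nZG := normal_norm nsZG.
have eX : residual F (G / 'Z(X))%G = (X / 'Z(X))%G.
  by apply: group_inj; rewrite residual_quotient.
rewrite -[_ / _]/(gval (X / 'Z(X))%G) -eX; apply: IHn.
- by rewrite eX (leq_trans _ leXn) // ltn_quotient ?center_sub.
- by rewrite eX; apply: quotient_ascending.
by rewrite eX pcore_quotient_center.
Qed.

Lemma boundary_I_of_eq :
  (forall (gT : finGroupType) (G :
    {group gT}), Ninf G = Z G) -> boundary_I pi F.
Proof.
move=> eqNZ gT G [nFG prF].
have ascG : ascending pi F G G.
  have sGZ : G \subset Z G.
    rewrite -eqNZ; apply: subset_trans (norm_piF_sub_infty pi formF G).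
    (* Residuals of proper subgroups are trivial and that of [G] is normal, so every element of [G]
       lies in the norm. *)
    apply/subsetP=> x Gx; apply/mem_norm_piF; split=> // H sHG.
    have nOx : x \in 'N('O_pi^'(G)) by rewrite (subsetP (gFnorm _ _)).
    have [eHG | neHG] := eqVneq H G.
      rewrite eHG; apply: (subsetP (normsM _ _) _ Gx); last exact: gFnorm.
      exact: normal_norm (residual_normal formF G).
    have FH : F H by apply: prF; rewrite properEneq neHG.
    by have /(residual_eq1P formF) -> := FH; rewrite mul1g.
  exact: ascendingS (ascending_hypercenter pi_primes formF F_S G) (normal_refl
    G) sGZ.
have nsXG : residual F G <| G by exact: residual_normal.
have ascX := ascendingS formF ascG nsXG (normal_sub nsXG).
rewrite /class_comp /pi_nilpotent_groups.
set E := 'O_pi^'(residual F G)%G.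
have nsEG : E <| G by exact: char_normal_trans (pcore_char _ _) nsXG.
have eX : residual F (G / E)%G = (residual F G / E)%G.
  by apply: group_inj; rewrite residual_quotient ?normal_norm.
rewrite -[_ / _]/(gval (residual F G / E)%G) -eX.
apply: ascending_residual_nil; rewrite eX; first exact: quotient_ascending.
exact: trivg_pcore_quotient.
Qed.

End MainTheorem.

Theorem theoremB (pi : nat_pred) (F : group_class)
    (pi_primes : forall p, p \in pi -> prime p)
    (formF : formation F) (F_S : subgroup_closed F) :
  [/\ boundary_II pi F ->
        forall (gT : finGroupType) (G : {group gT}),
          norm_infty pi F G = hypercenter pi (nilpotent_groups \oF F) G,
      (forall (gT : finGroupType) (G : {group gT}),
          norm_infty pi F G = hypercenter pi (nilpotent_groups \oF F) G) ->
        boundary_I pi F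
    & (forall (gT : finGroupType) (G : {group gT}),
          norm_infty pi F G = hypercenter pi (nilpotent_groups \oF F) G) <->
      (forall (gT : finGroupType) (G : {group gT}),
          (exists p, [/\ p \in pi,
             critS (p_groups p \oF F) G
           & ~ (pi_solvable_groups pi \oF F) G]) ->
          norm_infty pi F G = hypercenter pi (nilpotent_groups \oF F) G)].
Proof.
have eq_of gT (G : {group gT}) :
    norm_infty pi F G \subset hypercenter pi (nilpotent_groups \oF F) G ->
  norm_infty pi F G = hypercenter pi (nilpotent_groups \oF F) G.
  move=> sNZ; apply/group_inj/eqP.
  by rewrite eqEsubset sNZ hypercenter_sub_norm_infty.
split=> [bII gT G | | ].
(* Condition (II) says that there is no critical group, so the assumption on critical groups holds
   vacuously. *)
- apply/eq_of/norm_infty_sub_hypercenter => // rT H [p [pi_p critH nsolH]].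
  by case: nsolH; apply: bII critH.
- exact: boundary_I_of_eq.
split=> [eqNZ gT G _ | eq_crit gT G]; first exact: eqNZ.
by apply/eq_of/norm_infty_sub_hypercenter.
Qed.
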